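(* Let $\mathcal{B}=\mathcal{B}(\ell^2(\mathbb{N}))$ and let $\Gamma^\infty\subset\mathcal{B}$ be the subalgebra $\Gamma^\infty=\mathrm{span}\{\mathrm{diag}(\alpha)U_f:\alpha\in\ell^\infty,\ f\in\mathrm{Emb}\}$. The map $J\mapsto J\cap\Gamma^\infty$ is a bijection between the set of two-sided ideals of $\mathcal{B}$ and the set of two-sided ideals of $\Gamma^\infty$. If $S\triangleleft\ell^\infty$ is a symmetric ideal, then $J_S\cap\Gamma^\infty=I_S$.
   Context: All sequences are complex-valued and indexed by $\mathbb{N}=\{1,2,\dots\}$; $\ell^\infty$ is the algebra of bounded sequences. $\mathrm{Emb}$ is the inverse monoid of all partially defined injections $f:\mathrm{dom}(f)\to\mathbb{N}$, $\mathrm{dom}(f)\subset\mathbb{N}$, under composition of partial maps; $f^\dagger:\mathrm{ran}(f)\to\mathbb{N}$ denotes the inverse of $f$. $\mathrm{Emb}$ acts on $\ell^\infty$ by $f_*(\alpha)_n=\alpha_{f^\dagger(n)}$ if $n\in\mathrm{ran}(f)$ and $f_*(\alpha)_n=0$ otherwise. An ideal $S\triangleleft\ell^\infty$ is symmetric if $f_*(S)\subset S$ for all $f\in\mathrm{Emb}$. With $(e_n)$ the canonical basis of $\ell^2(\mathbb{N})$, $U_f\in\mathcal{B}$ is defined by $U_f(e_n)=e_{f(n)}$ if $n\in\mathrm{dom}(f)$ and $U_f(e_n)=0$ otherwise; $\mathrm{diag}(\alpha)(e_n)=\alpha_ne_n$. For a symmetric ideal $S$: $I_S=\mathrm{span}\{\mathrm{diag}(\alpha)U_f:\alpha\in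 S,\ f\in\mathrm{Emb}\}$, and $J_S\triangleleft\mathcal{B}$ is the ideal corresponding to $S$ under Calkin's correspondence, i.e. the two-sided ideal of $\mathcal{B}$ generated by $\{\mathrm{diag}(\alpha):\alpha\in S\}$ (for $S$ proper, equivalently the ideal of compact operators whose sequence of singular values lies in $S$; $J_{\ell^\infty}=\mathcal{B}$). Ideals may be zero or the whole algebra. *)

(* Defs.v *)
From HB Require Import structures.
From mathcomp Require Import all_boot all_order all_algebra.
From mathcomp Require Import complex.
From mathcomp Require Import ring.
From mathcomp Require Import all_classical all_reals all_analysis.
Set Implicit Arguments.
Unset Strict Implicit.
Unset Printing Implicit Defensive.
Import Order.TTheory GRing.Theory Num.Theory.
Import numFieldNormedType.Exports.
Import ComplexField.Normc.

Local Open Scope classical_set_scope.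
Local Open Scope ring_scope.

Local Arguments normc {R} x : simpl never.

Section AlgebraIdeals.
Variables (C : nzRingType) (A : algType C).
Implicit Types (D J E : set A).

Definition two_sided_ideal D J : Prop :=
  [/\ J `<=` D, J 0,
      forall c x y, J x -> J y -> J (c *: x + y)
    & forall a x, D a -> J x -> J (a * x) /\ J (x * a)].

Definition ideal_generated_by E : set A := smallest (two_sided_ideal setT) E.

End AlgebraIdeals.

Definition linear_span (C : nzRingType) (V : lmodType C) (E : set V) : set V :=
  [set x | exists n (c : 'I_n -> C) (v : 'I_n -> V),
     (forall i, E (v i)) /\ x = \sum_i c i *: v i].

Section BoundedSequences.
Variable R : realType.
Local Notation C := R[i].

Definition bounded_seq : {pred nat -> C} :=
  fun a => `[< exists M : R, forall n, normc (a n) <= M >].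

Lemma bounded_seqP (a : nat -> C) :
  reflect (exists M : R, forall n, normc (a n) <= M) (a \in bounded_seq).
Proof. exact: asboolP. Qed.

Lemma bounded_seq_submod : submod_closed bounded_seq.
Proof.
split=> [|c x y /bounded_seqP[M hM] /bounded_seqP[N hN]]; apply/bounded_seqP.
  by exists 0 => n; rewrite normc0.
exists (normc c * M + N) => n.
apply: (le_trans (@le_normcD R (c * x n) (y n))); rewrite normcM lerD//.
by apply: ler_wpM2l => //; case: (c) => u v; exact: sqrtr_ge0.
Qed.

Lemma bounded_seq_subring : subring_closed bounded_seq.
Proof.
have [_ lin] := bounded_seq_submod.
split=> [|x y xS yS|x y /bounded_seqP[M hM] /bounded_seqP[N hN]].
- by apply/bounded_seqP; exists 1 => n; rewrite normc1.
- by have := lin (-1) y x yS xS; rewrite scaleN1r addrC.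
- apply/bounded_seqP; exists (M * N) => n; rewrite normcM.
  have nn z : 0 <= normc z :> R by case: z => u v; exact: sqrtr_ge0.
  exact: ler_pM.
Qed.

HB.instance Definition _ :=
  GRing.isSubmodClosed.Build _ _ bounded_seq bounded_seq_submod.
HB.instance Definition _ :=
  GRing.isSubringClosed.Build _ bounded_seq bounded_seq_subring.

(* $\ell^\infty$; sequences are indexed from 0, by nat in place of {1, 2, ...} *)
Record linf : Type := Linf {
  linf_fun :> nat -> C;
  linf_bounded : linf_fun \in bounded_seq }.

HB.instance Definition _ := [isSub for linf_fun].
HB.instance Definition _ := [Choice of linf by <:].
HB.instance Definition _ := [SubChoice_isSubNzRing of linf by <:].
HB.instance Definition _ := [SubZmodule_isSubLmodule of linf by <:].

Lemma linf_scalerAl (c : C) (x y : linf) : c *: (x * y) = (c *: x) * y.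
Proof. by apply/val_inj/funext => n; exact: mulrA. Qed.

Lemma linf_scalerAr (c : C) (x y : linf) : c *: (x * y) = x * (c *: y).
Proof. by apply/val_inj/funext => n; exact: mulrCA. Qed.

HB.instance Definition _ := GRing.Lmodule_isLalgebra.Build C linf linf_scalerAl.
HB.instance Definition _ := GRing.Lalgebra_isAlgebra.Build C linf linf_scalerAr.

End BoundedSequences.

Section SquareSummable.
Variable R : realType.
Local Notation C := R[i].
Implicit Types x y : nat -> C.

Definition sqsum x : R^nat := series (fun n => normc (x n) ^+ 2).

Definition square_summable : {pred nat -> C} := fun x => `[< cvgn (sqsum x) >].

Lemma nondecreasing_sqsum x : nondecreasing_seq (sqsum x).
Proof.
by apply: (@nondecreasing_series _ _ xpredT 0) => n _ _; exact: sqr_ge0.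
Qed.

Lemma square_summableP x :
  reflect (exists M, forall n, sqsum x n <= M) (x \in square_summable).
Proof.
apply: (iffP (asboolP _)) => [cx|[M hM]].
  by exists (limn (sqsum x)) => n;
  exact: (nondecreasing_cvgn_le (@nondecreasing_sqsum x)).
apply: nondecreasing_is_cvgn; first exact: nondecreasing_sqsum.
by exists M => _ [n _ <-].
Qed.

Lemma sqsum_lin (c : C) x y n :
  sqsum (c *: x + y) n <= 2 * normc c ^+ 2 * sqsum x n + 2 * sqsum y n.
Proof.
rewrite /sqsum /series /= !mulr_sumr -big_split /= ler_sum// => i _.
have nn z : 0 <= normc z :> R by case: z => u v; exact: sqrtr_ge0.
apply: (@le_trans _ _ ((normc (c * x i) + normc (y i)) ^+ 2)).
  by rewrite ler_sqr ?nnegrE ?addr_ge0//; exact: (@le_normcD R (c * x i) (y i)).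
rewrite normcM -subr_ge0.
set a := normc c; set b := normc (x i); set d := normc (y i).
have -> : 2 * a ^+ 2 * b ^+ 2 + 2 * d ^+ 2 - (a * b + d) ^+ 2
          = (a * b - d) ^+ 2 by ring.
exact: sqr_ge0.
Qed.

Lemma square_summable_submod : submod_closed square_summable.
Proof.
split=> [|c x y /square_summableP[M hM] /square_summableP[N hN]];
    apply/square_summableP.
  exists 0 => n; rewrite /sqsum /series /= big1// => i _.
  by rewrite normc0 expr0n.
exists (2 * normc c ^+ 2 * M + 2 * N) => n.
apply: (le_trans (sqsum_lin c x y n)); apply: lerD; apply: ler_wpM2l => //.
by rewrite mulr_ge0 ?sqr_ge0.
Qed.

HB.instance Definition _ :=
  GRing.isSubmodClosed.Build _ _ square_summable square_summable_submod.

Record ell2 : Type := Ell2 {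
  ell2_fun :> nat -> C;
  ell2_summable : ell2_fun \in square_summable }.

HB.instance Definition _ := [isSub for ell2_fun].
HB.instance Definition _ := [Choice of ell2 by <:].
HB.instance Definition _ := [SubChoice_isSubLmodule of ell2 by <:].

Definition ell2_norm (x : ell2) : R := Num.sqrt (limn (sqsum x)).

Lemma sqsum_le (x : ell2) n : sqsum x n <= limn (sqsum x).
Proof.
apply: nondecreasing_cvgn_le; first exact: nondecreasing_sqsum.
exact/asboolP/ell2_summable.
Qed.

Lemma sqr_ell2_norm (x : ell2) : ell2_norm x ^+ 2 = limn (sqsum x).
Proof.
by rewrite sqr_sqrtr// (le_trans _ (sqsum_le x 0))// /sqsum /series /= big_geq.
Qed.

Lemma ell2_norm_ge0 (x : ell2) : 0 <= ell2_norm x. Proof. exact: sqrtr_ge0. Qed.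

Lemma sqsum_le_norm (x : ell2) n : sqsum x n <= ell2_norm x ^+ 2.
Proof. by rewrite sqr_ell2_norm sqsum_le. Qed.

Lemma ell2_norm_le (x : ell2) (K : R) :
  (forall n, sqsum x n <= K) -> ell2_norm x <= Num.sqrt K.
Proof.
move=> xK; apply: ler_wsqrtr; apply: limr_le; last exact: nearW.
exact/asboolP/ell2_summable.
Qed.

Fact ell2_basis_summable n :
  (fun k => (k == n)%:R : C) \in square_summable.
Proof.
apply/square_summableP; exists 1 => m; rewrite /sqsum /series /=.
rewrite (bigID (pred1 n)) /= [X in _ + X]big1 ?addr0; last first.
  by move=> i /negPf ->; rewrite normc0 expr0n.
rewrite big_mkcond /= big_mkord.
have [nm|mn] := ltnP n m.
  rewrite (bigD1 (Ordinal nm)) //= eqxx normc1 expr1n big1 ?addr0//.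
  by move=> i /eqP ni; case: eqP => // e; case: ni; apply/val_inj.
rewrite big1// => i _; case: eqP => // e.
by move: (ltn_ord i); rewrite e ltnNge mn.
Qed.

Definition ell2_basis n : ell2 := Ell2 (ell2_basis_summable n).

End SquareSummable.

Section BoundedOperators.
Variable R : realType.
Local Notation C := R[i].
Local Notation ell2 := (ell2 R).

Definition bounded_linear : {pred ell2 -> ell2} := fun T =>
  `[< linear T /\ exists M : R, forall x, ell2_norm (T x) <= M * ell2_norm x >].

Lemma bounded_linearP (T : ell2 -> ell2) :
  reflect (linear T /\ exists M : R, forall x, ell2_norm (T x) <= M * ell2_norm x)
          (T \in bounded_linear).
Proof. exact: asboolP. Qed.

Lemma bounded_linearW (T : ell2 -> ell2) (K : R) : linear T ->
  (forall x n, sqsum (T x) n <= K * ell2_norm x ^+ 2) -> T \in bounded_linear.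
Proof.
move=> linT TK; apply/bounded_linearP; split => //; exists (Num.sqrt `|K|) => x.
have <- : Num.sqrt (ell2_norm x ^+ 2) = ell2_norm x.
  by rewrite sqrtr_sqr ger0_norm// ell2_norm_ge0.
rewrite -sqrtrM ?normr_ge0//; apply: ell2_norm_le => n.
by rewrite (le_trans (TK x n))// ler_wpM2r ?sqr_ge0// ler_norm.
Qed.

Lemma bounded_linear_submod : submod_closed bounded_linear.
Proof.
split=> [|c S T /bounded_linearP[linS [M SM]] /bounded_linearP[linT [N TN]]].
  apply/bounded_linearP; split=> [a x y|].
    by change (0 = a *: (0 : ell2) + 0); rewrite scaler0 addr0.
  exists 0 => x; rewrite mul0r; apply: (le_trans (ell2_norm_le (K := 0) _)).
    by move=> n; rewrite /sqsum /series /= big1// => i _; rewrite normc0 expr0n.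
  by rewrite sqrtr0.
apply: (@bounded_linearW _ (2 * normc c ^+ 2 * M ^+ 2 + 2 * N ^+ 2)).
  move=> a x y; rewrite !fctE linS linT.
  rewrite !scalerDr !scalerA (mulrC c a) -!addrA; congr (_ + _).
  by rewrite addrCA.
move=> x n; apply: (le_trans (sqsum_lin c (S x) (T x) n)).
have sq (U : ell2 -> ell2) K : (forall x, ell2_norm (U x) <= K * ell2_norm x) ->
    sqsum (U x) n <= K ^+ 2 * ell2_norm x ^+ 2.
  move=> UK; apply: (le_trans (sqsum_le_norm _ _)); rewrite -exprMn.
  rewrite ler_sqr ?nnegrE ?ell2_norm_ge0//.
  exact: le_trans (ell2_norm_ge0 _) (UK x).
rewrite [leRHS]mulrDl -(mulrA _ (M ^+ 2)) -(mulrA _ (N ^+ 2)).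
apply: lerD; apply: ler_wpM2l => //; [|exact: sq|exact: sq].
by rewrite mulr_ge0 ?sqr_ge0.
Qed.

HB.instance Definition _ :=
  GRing.isSubmodClosed.Build _ _ bounded_linear bounded_linear_submod.

(* $\mathcal{B}(\ell^2)$ *)
Record bop : Type := Bop {
  bop_fun :> ell2 -> ell2;
  bop_bounded : bop_fun \in bounded_linear }.

HB.instance Definition _ := [isSub for bop_fun].
HB.instance Definition _ := [Choice of bop by <:].
HB.instance Definition _ := [SubChoice_isSubLmodule of bop by <:].

Fact id_bounded : (id : ell2 -> ell2) \in bounded_linear.
Proof. by apply/bounded_linearP; split=> //; exists 1 => x; rewrite mul1r. Qed.

Fact comp_bounded (S T : bop) : (S \o T : ell2 -> ell2) \in bounded_linear.
Proof.
have /bounded_linearP[linS [M SM]] := bop_bounded S.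
have /bounded_linearP[linT [N TN]] := bop_bounded T.
apply/bounded_linearP; split=> [a x y|]; first by rewrite /= linT linS.
exists (`|M| * N) => x; apply: (le_trans (SM _)) => /=.
apply: (@le_trans _ _ (`|M| * ell2_norm (T x))).
  by rewrite ler_wpM2r ?ell2_norm_ge0// ler_norm.
by rewrite -mulrA ler_wpM2l.
Qed.

Definition bop_one : bop := Bop id_bounded.
Definition bop_mul (S T : bop) : bop := Bop (comp_bounded S T).

Lemma bop_mulA : associative bop_mul.
Proof. by move=> S T U; apply/val_inj. Qed.
Lemma bop_mul1r : left_id bop_one bop_mul.
Proof. by move=> S; apply/val_inj. Qed.
Lemma bop_mulr1 : right_id bop_one bop_mul.
Proof. by move=> S; apply/val_inj. Qed.
Lemma bop_mulDl : left_distributive bop_mul +%R.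
Proof. by move=> S T U; apply/val_inj. Qed.
Lemma bop_mulDr : right_distributive bop_mul +%R.
Proof.
move=> S T U; apply/val_inj/funext => x /=.
have /bounded_linearP[linS _] := bop_bounded S.
by have := linS 1 (T x) (U x); rewrite !scale1r.
Qed.
Lemma bop_1_neq0 : bop_one != 0.
Proof.
apply/eqP => /(congr1 (fun T : bop => T (ell2_basis R 0) 0%N))/eqP.
by rewrite /= oner_eq0.
Qed.

HB.instance Definition _ := GRing.Zmodule_isNzRing.Build bop
  bop_mulA bop_mul1r bop_mulr1 bop_mulDl bop_mulDr bop_1_neq0.

Lemma bop_scalerAl (c : C) (S T : bop) : c *: (S * T) = (c *: S) * T.
Proof. by apply/val_inj. Qed.
Lemma bop_scalerAr (c : C) (S T : bop) : c *: (S * T) = S * (c *: T).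
Proof.
apply/val_inj/funext => x /=; have /bounded_linearP[linS _] := bop_bounded S.
have S0 : S 0 = 0 by have := linS (-1) 0 0; rewrite scaler0 addr0 scaleN1r addNr.
by have := linS c (T x) 0; rewrite !addr0 S0 addr0.
Qed.

HB.instance Definition _ := GRing.Lmodule_isLalgebra.Build C bop bop_scalerAl.
HB.instance Definition _ := GRing.Lalgebra_isAlgebra.Build C bop bop_scalerAr.

End BoundedOperators.

Section PartialInjections.

(* None marks the points outside the domain. *)
Record emb : Type := Emb {
  emb_fun :> nat -> option nat;
  emb_inj : forall m n k, emb_fun m = Some k -> emb_fun n = Some k -> m = n }.

Definition emb_inv_fun (f : emb) (n : nat) : option nat :=
  if pselect (exists m, f m == Some n) is left h then Some (xchoose h) else None.

Lemma emb_inv_funP (f : emb) m n : emb_inv_fun f n = Some m <-> f m = Some n.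
Proof.
rewrite /emb_inv_fun; case: pselect => [h|nh]; last first.
  by split=> // fm; case: nh; exists m; rewrite fm.
have /eqP fh := xchooseP h; split=> [[<-]//|fm]; congr Some.
exact: emb_inj fh fm.
Qed.

Fact emb_inv_inj (f : emb) m n k :
  emb_inv_fun f m = Some k -> emb_inv_fun f n = Some k -> m = n.
Proof. by move=> /emb_inv_funP fm /emb_inv_funP; rewrite fm => -[]. Qed.

(* $f^\dagger$ *)
Definition emb_inv (f : emb) : emb := Emb (@emb_inv_inj f).

Fact emb_comp_inj (f g : emb) m n k :
  obind f (g m) = Some k -> obind f (g n) = Some k -> m = n.
Proof.
case gm: (g m) => [i|] //= fi; case gn: (g n) => [j|] //= fj.
by apply: (emb_inj gm); rewrite gn (emb_inj fi fj).
Qed.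

Definition emb_comp (f g : emb) : emb := Emb (@emb_comp_inj f g).

Fact emb_id_inj (m n k : nat) : Some m = Some k -> Some n = Some k -> m = n.
Proof. by move=> [->] [->]. Qed.

Definition emb_id : emb := Emb emb_id_inj.

Lemma emb_inv_comp (f g : emb) n :
  emb_inv (emb_comp f g) n = obind (emb_inv g) (emb_inv f n).
Proof.
have P (o1 o2 : option nat) :
    (forall m, o1 = Some m <-> o2 = Some m) -> o1 = o2.
  case: o1 o2 => [a|] [b|] // h; first exact/esym/(h a).
    by have := (h a).1 erefl.
  by have := (h b).2 erefl.
apply: P => m /=; split.
  move=> /emb_inv_funP /=; case gm: (g m) => [i|] //= /emb_inv_funP ->.
  exact/emb_inv_funP.
case E: (emb_inv_fun f n) => [i|] //= /emb_inv_funP gm; apply/emb_inv_funP.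
by rewrite /= gm; exact/emb_inv_funP.
Qed.

End PartialInjections.

Section Operators.
Variable R : realType.
Local Notation C := R[i].

(* $f_*(x)_n = x_{f^\dagger(n)}$ if $n \in \mathrm{ran}(f)$, and $0$ otherwise *)
Definition push (f : emb) (x : nat -> C) : nat -> C :=
  fun n => oapp x 0 (emb_inv f n).

Fact push_bounded (f : emb) (a : linf R) : push f a \in @bounded_seq R.
Proof.
have /bounded_seqP[M aM] := linf_bounded a; apply/bounded_seqP.
exists M => n; rewrite /push; case: (emb_inv f n) => //=.
rewrite normc0; apply: le_trans (aM 0%N).
by case: (a 0%N) => u v; exact: sqrtr_ge0.
Qed.

Definition push_linf (f : emb) (a : linf R) : linf R := Linf (push_bounded f a).

Lemma sqsum_push (f : emb) (x : nat -> C) n :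
  exists m, sqsum (push f x) n <= sqsum x m.
Proof.
rewrite /push; case: (emb_inv f) => g ginj /=.
pose s := pmap g (iota 0 n).
have us : uniq s.
  rewrite /s; elim: (iota 0 n) (iota_uniq 0 n) => //= k t IH /andP[kt ut].
  case E: (g k) => [j|] /=; last exact: IH.
  rewrite IH// andbT; apply/negP; rewrite mem_pmap => /mapP[i it Ei].
  by move: kt; rewrite (ginj _ _ _ E (esym Ei)) it.
exists (\max_(i <- s) i).+1.
have -> : sqsum (fun k => oapp x 0 (g k)) n = \sum_(i <- s) normc (x i) ^+ 2.
  rewrite /sqsum /series /= /index_iota subn0 /s.
  elim: (iota 0 n) => [|k t IH]; first by rewrite !big_nil.
  rewrite big_cons IH /=; case: (g k) => [j|] /=.
    by rewrite big_cons.
  by rewrite normc0 expr0n add0r.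
rewrite /sqsum /series /=.
rewrite [leRHS](bigID (mem s)) /= -[leLHS]addr0 lerD ?sumr_ge0//; last first.
  by move=> *; exact: sqr_ge0.
rewrite -[X in _ <= X]big_filter.
rewrite (perm_big [seq i <- index_iota 0 (\max_(i <- s) i).+1 | i \in s])//.
apply: uniq_perm => //; first by rewrite filter_uniq// iota_uniq.
move=> i; rewrite mem_filter mem_index_iota /= ltnS.
by case: (boolP (i \in s)) => //= si; rewrite (leq_bigmax_seq _ (F := id) si).
Qed.

Fact push_summable (f : emb) (x : ell2 R) : push f x \in @square_summable R.
Proof.
apply/square_summableP; exists (ell2_norm x ^+ 2) => n.
have [m h] := sqsum_push f x n; exact: le_trans h (sqsum_le_norm x m).
Qed.

Definition push_ell2 (f : emb) (x : ell2 R) : ell2 R := Ell2 (push_summable f x).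

Fact push_bounded_linear (f : emb) : push_ell2 f \in @bounded_linear R.
Proof.
apply: (@bounded_linearW _ _ 1) => [c x y|x n].
  apply/val_inj/funext => n; rewrite /= /push !fctE /=.
  case: emb_inv_fun => [k|] //=.
  by change (0 = c * 0 + 0 :> C); rewrite mulr0 addr0.
rewrite mul1r; have [m h] := sqsum_push f x n.
exact: le_trans h (sqsum_le_norm x m).
Qed.

(* U_f is given by its action on vectors; U_basis recovers its defining action
   on the canonical basis. *)
Definition U_ (f : emb) : bop R := Bop (push_bounded_linear f).

Lemma U_basis (f : emb) n :
  U_ f (ell2_basis R n) = oapp (ell2_basis R) 0 (f n).
Proof.
apply/val_inj/funext => k /=; rewrite /push /=.
case E: (emb_inv_fun f k) => [m|] /=.
  have /emb_inv_funP fm := E.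
  have [<-|mn] := eqVneq m n; first by rewrite fm /= eqxx.
  case F: (f n) => [j|] //=; have [kj|//] := eqVneq k j.
  by move: mn; rewrite kj in fm; rewrite (emb_inj fm F) eqxx.
case F: (f n) => [j|] //=; have [kj|//] := eqVneq k j.
by move: F; rewrite -kj => /emb_inv_funP; rewrite E.
Qed.

Lemma sqsum_mul (a : linf R) : exists K : R, forall (x : ell2 R) n,
  sqsum (fun k => a k * x k) n <= K * ell2_norm x ^+ 2.
Proof.
have /bounded_seqP[M aM] := linf_bounded a.
have nn z : 0 <= normc z :> R by case: z => u v; exact: sqrtr_ge0.
exists (M ^+ 2) => x n.
apply: (@le_trans _ _ (M ^+ 2 * sqsum x n)); last first.
  by rewrite ler_wpM2l ?sqr_ge0// sqsum_le_norm.
rewrite /sqsum /series /= mulr_sumr ler_sum// => i _.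
rewrite normcM exprMn ler_wpM2r ?sqr_ge0// ler_sqr ?nnegrE//.
exact: le_trans (nn _) (aM i).
Qed.

Fact mul_summable (a : linf R) (x : ell2 R) :
  (fun n => a n * x n) \in @square_summable R.
Proof.
have [K aK] := sqsum_mul a; apply/square_summableP.
by exists (K * ell2_norm x ^+ 2).
Qed.

Definition mul_ell2 (a : linf R) (x : ell2 R) : ell2 R := Ell2 (mul_summable a x).

Fact mul_bounded_linear (a : linf R) : mul_ell2 a \in @bounded_linear R.
Proof.
have [K aK] := sqsum_mul a; apply: (@bounded_linearW _ _ K) => [c x y|x n].
  apply/val_inj/funext => n; rewrite /= !fctE mulrDr; congr (_ + _).
  exact: mulrCA.
exact: aK.
Qed.

Definition diag (a : linf R) : bop R := Bop (mul_bounded_linear a).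

Lemma diag_basis (a : linf R) n :
  diag a (ell2_basis R n) = a n *: ell2_basis R n.
Proof.
apply/val_inj/funext => k /=; rewrite !fctE.
by have [->//|_] := eqVneq k n; rewrite mulr0 scaler0.
Qed.

Lemma U_comp (f g : emb) : U_ f * U_ g = U_ (emb_comp f g).
Proof.
apply/val_inj/funext => x; apply/val_inj/funext => n.
change (push f (push g x) n = push (emb_comp f g) x n).
by rewrite /push emb_inv_comp; case: (emb_inv f n).
Qed.

Lemma U_id : U_ emb_id = 1.
Proof.
apply/val_inj/funext => x; apply/val_inj/funext => n.
rewrite /= /push /=; case E: (emb_inv_fun emb_id n) => [m|] /=.
  by move/emb_inv_funP: E => [->].
by have /emb_inv_funP : emb_id n = Some n by []; rewrite E.
Qed.

Lemma diag1 : diag 1 = 1.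
Proof. by apply/val_inj/funext=> x; apply/val_inj/funext=> n; exact: mul1r. Qed.

Lemma diagM (a b : linf R) : diag (a * b) = diag a * diag b.
Proof.
by apply/val_inj/funext => x; apply/val_inj/funext => n; exact/esym/mulrA.
Qed.

Lemma U_diag (f : emb) (a : linf R) :
  U_ f * diag a = diag (push_linf f a) * U_ f.
Proof.
apply/val_inj/funext => x; apply/val_inj/funext => n.
rewrite /= /push /=; case: emb_inv_fun => [k|] //=.
by rewrite mulr0.
Qed.

Definition symmetric_ideal (S : set (linf R)) : Prop :=
  two_sided_ideal setT S /\ forall f, push_linf f @` S `<=` S.

Definition I_ (S : set (linf R)) : set (bop R) :=
  linear_span [set diag a * U_ f | a in S & f in [set: emb]].

Definition J_ (S : set (linf R)) : set (bop R) :=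
  ideal_generated_by (diag @` S).

(* $\Gamma^\infty$ *)
Definition Gamma : set (bop R) := I_ setT.

Lemma Gamma1 : Gamma 1.
Proof.
exists 1%N, (fun=> 1), (fun=> 1); split; last by rewrite big_ord1 scale1r.
by move=> _; exists 1 => //; exists emb_id => //; rewrite diag1 U_id mulr1.
Qed.

Lemma GammaM : forall S T, Gamma S -> Gamma T -> Gamma (S * T).
Proof.
move=> _ _ [m [c [v [Ev ->]]]] [n [d [w [Ew ->]]]].
have EM i j : [set diag a * U_ f | a in [set: linf R] & f in [set: emb]]
                (v i * w j).
  have [a _ [f _ <-]] := Ev i; have [b _ [g _ <-]] := Ew j.
  exists (a * push_linf f b) => //; exists (emb_comp f g) => //.
  by rewrite diagM -U_comp -!mulrA; congr (_ * _); rewrite !mulrA U_diag.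
exists #|{: 'I_m * 'I_n}|, (fun k => c (enum_val k).1 * d (enum_val k).2),
  (fun k => v (enum_val k).1 * w (enum_val k).2); split=> [k|]; first exact: EM.
rewrite -(big_enum_val (A := {: 'I_m * 'I_n})
  (fun p => (c p.1 * d p.2) *: (v p.1 * w p.2))) /=.
rewrite mulr_suml -(pair_bigA _ (fun i j => (c i * d j) *: (v i * w j))) /=.
apply: eq_bigr => i _; rewrite mulr_sumr; apply: eq_bigr => j _.
by rewrite -scalerAl -scalerAr scalerA.
Qed.

End Operators.

Arguments Gamma R : clear implicits.

(* Main.v *)
(* Every operator x is, in suitable orthonormal bases, a direct sum of bidiagonal
   matrices: run the Lanczos recursion alternately with x and its adjoint, starting
   in turn from the part of each basis vector that is orthogonal to the Krylov
   spaces already found.  Thus x = A' y B' and y = A x B with y bidiagonal, hence in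
   Gamma, so an ideal of B is determined by its trace on Gamma; neither the spectral
   theorem nor polar decomposition is needed.

   Elements of Gamma have finitely many nonzero entries in each row and column,
   uniformly.  A greedy colouring of rows and columns cuts such a matrix into
   finitely many pieces diag(a) U_g by diagonal projections, so every ideal of Gamma
   is I_T for T its set of diagonals.

   It remains to see that diag(a) in J_S forces a in S.  If S contains a sequence
   not tending to 0, S is everything.  Otherwise, off a finite set E of indices,
   s in S is at most t, and every x in J_S is bounded by t on a subspace of
   codimension K |E|; for x = diag(a) this compares the decreasing rearrangements
   of |a| and |s|, and the symmetry of S concludes. *)
Require Import Defs.
From HB Require Import structures.
From mathcomp Require Import all_boot all_order all_algebra.
From mathcomp Require Import complex ring zify.
From mathcomp Require Import all_classical all_reals all_analysis.
Set Implicit Arguments.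
Unset Strict Implicit.
Unset Printing Implicit Defensive.
Import Order.TTheory GRing.Theory Num.Theory.
Import numFieldNormedType.Exports.
Import ComplexField.Normc.

Local Open Scope classical_set_scope.
Local Open Scope ring_scope.

Local Arguments normc {R} x : simpl never.

(** * The inner product of l2 and adjoints *)

Section InnerProduct.
Variable R : realType.
Local Notation C := R[i].
Local Notation ell2 := (ell2 R).
Local Notation bop := (bop R).
Implicit Types (x y z : ell2) (T : bop) (u v : nat -> C) (a b l : C).

Lemma normc_ge0 a : 0 <= normc a.
Proof. by case: a => p q; exact: sqrtr_ge0. Qed.

Lemma normc_sqrE a : normc a ^+ 2 = complex.Re a ^+ 2 + complex.Im a ^+ 2.
Proof. by case: a => p q; rewrite sqr_sqrtr// addr_ge0 ?sqr_ge0. Qed.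

Lemma mul_conjc a : a * (a^*)%C = (normc a ^+ 2)%:C%C.
Proof.
rewrite normc_sqrE; case: a => p q.
by congr Complex => /=; ring.
Qed.

Lemma conjcM a b : ((a * b)^*)%C = a^*%C * b^*%C.
Proof. exact: rmorphM. Qed.

Lemma normc_real (r : R) : normc (r%:C)%C = `|r|.
Proof. by rewrite /normc /= expr0n addr0 sqrtr_sqr. Qed.

Lemma abs_Re_le a : `|complex.Re a| <= normc a.
Proof.
rewrite -sqrtr_sqr -[leRHS]ger0_norm ?normc_ge0// -[leRHS]sqrtr_sqr.
by apply: ler_wsqrtr; rewrite normc_sqrE lerDl sqr_ge0.
Qed.

Lemma abs_Im_le a : `|complex.Im a| <= normc a.
Proof.
rewrite -sqrtr_sqr -[leRHS]ger0_norm ?normc_ge0// -[leRHS]sqrtr_sqr.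
by apply: ler_wsqrtr; rewrite normc_sqrE lerDr sqr_ge0.
Qed.

(** Splitting into real and imaginary parts lets real limit lemmas apply to each component. *)
Definition ccvg u l :=
  (complex.Re (u n) @[n --> \oo] --> complex.Re l) /\
  (complex.Im (u n) @[n --> \oo] --> complex.Im l).

Lemma ccvg_unique u l l' : ccvg u l -> ccvg u l' -> l = l'.
Proof.
case: l l' => p q [p' q'] [/= h1 h2] [/= k1 k2].
by congr Complex; [apply: cvg_unique h1 k1|apply: cvg_unique h2 k2].
Qed.

Lemma ccvgD u v l l' : ccvg u l -> ccvg v l' -> ccvg (fun n => u n + v n) (l + l').
Proof.
move=> [u1 u2] [v1 v2]; split.
  under eq_fun do rewrite raddfD /=.
  by rewrite raddfD; exact: cvgD.
under eq_fun do rewrite raddfD /=.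
by rewrite raddfD; exact: cvgD.
Qed.

Lemma ReM a b : complex.Re (a * b) =
  complex.Re a * complex.Re b - complex.Im a * complex.Im b.
Proof. by case: a b => p q []. Qed.

Lemma ImM a b : complex.Im (a * b) =
  complex.Re a * complex.Im b + complex.Im a * complex.Re b.
Proof. by case: a b => p q []. Qed.

Lemma ccvgZ u a l : ccvg u l -> ccvg (fun n => a * u n) (a * l).
Proof.
move=> [u1 u2]; split.
  under eq_fun do rewrite ReM.
  by rewrite ReM; apply: cvgB; apply: cvgMr.
under eq_fun do rewrite ImM.
by rewrite ImM; apply: cvgD; apply: cvgMr.
Qed.

Lemma ccvg_conj u l : ccvg u l -> ccvg (fun n => (u n)^*%C) (l^*%C).
Proof.
have Rc a : complex.Re (a^*)%C = complex.Re a by case: a.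
have Ic a : complex.Im (a^*)%C = - complex.Im a by case: a.
move=> [u1 u2]; split.
  by under eq_fun do rewrite Rc; rewrite Rc.
by under eq_fun do rewrite Ic; rewrite Ic; exact: cvgN.
Qed.

Lemma ccvg_squeeze u l (e : R^nat) :
  (forall n, normc (u n - l) <= e n) -> e @ \oo --> 0 -> ccvg u l.
Proof.
move=> ue e0.
have sq (f : R^nat) (m : R) : (forall n, `|f n - m| <= e n) -> f @ \oo --> m.
  move=> fe; apply/cvgrPdist_lt => eps eps0.
  move/cvgrPdist_lt: e0 => /(_ _ eps0); apply: filterS => n.
  rewrite sub0r normrN distrC => h; apply: le_lt_trans (fe n) _.
  exact: le_lt_trans (ler_norm _) h.
split; apply: sq => n; apply: le_trans (ue n).
  by rewrite -raddfB abs_Re_le.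
by rewrite -raddfB abs_Im_le.
Qed.

Definition dots u v n : C := \sum_(i < n) u i * (v i)^*%C.

Lemma dotsC u v n : dots v u n = ((dots u v n)^*)%C.
Proof.
by rewrite /dots rmorph_sum; apply: eq_bigr => i _; rewrite rmorphM /= conjcK mulrC.
Qed.

Lemma dots_diag u n : dots u u n = (sqsum u n)%:C%C.
Proof.
rewrite /dots /sqsum /series /= big_mkord rmorph_sum.
by apply: eq_bigr => i _; rewrite mul_conjc.
Qed.

Lemma dotsDl u v w n a :
  dots (a *: u + v) w n = a * dots u w n + dots v w n.
Proof.
rewrite /dots mulr_sumr -big_split; apply: eq_bigr => i _ /=.
by rewrite !fctE mulrDl mulrA.
Qed.

Lemma cvg_sqsum x : sqsum x @ \oo --> ell2_norm x ^+ 2.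
Proof. by rewrite sqr_ell2_norm; exact/asboolP/ell2_summable. Qed.

(* Polarization reduces convergence of the inner product to that of norms. *)
Lemma cvg_Re_dots x y : cvgn (fun n => complex.Re (dots x y n)).
Proof.
have E n : complex.Re (dots x y n) =
    4^-1 * (sqsum (1 *: x + y) n - sqsum (-1 *: x + y) n).
  rewrite /sqsum /series /= -sumrB mulr_sumr big_mkord /dots raddf_sum.
  apply: eq_bigr => i _ /=; rewrite !normc_sqrE !fctE !raddfD /=.
  rewrite ReM scale1r scaleN1r !raddfN /=.
  by case: (x i) (y i) => p q [p' q'] /=; field.
apply/cvg_ex; exists (4^-1 * (ell2_norm (1 *: x + y) ^+ 2 - ell2_norm (-1 *: x + y) ^+ 2)).
under eq_fun do rewrite E.
by apply: cvgMr; apply: cvgB; exact: cvg_sqsum.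
Qed.

Lemma cvg_Im_dots x y : cvgn (fun n => complex.Im (dots x y n)).
Proof.
suff -> : (fun n => complex.Im (dots x y n)) =
    (fun n => complex.Re (dots x ('i%C *: y) n)) by exact: cvg_Re_dots.
apply/funext => n; rewrite /dots !raddf_sum; apply: eq_bigr => i _ /=; rewrite fctE.
by rewrite ReM ImM; case: (x i) (y i) => p q [p' q'] /=; ring.
Qed.

Definition dot x y : C :=
  Complex (limn (fun n => complex.Re (dots x y n)))
          (limn (fun n => complex.Im (dots x y n))).

Local Arguments dot : simpl never.

Lemma ccvg_dot x y : ccvg (dots x y) (dot x y).
Proof. by split; [exact: cvg_Re_dots|exact: cvg_Im_dots]. Qed.

Lemma dotP z a x y : dot (a *: x + y) z = a * dot x z + dot y z.
Proof.
apply: ccvg_unique (ccvg_dot _ _) _.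
have := ccvgD (ccvgZ a (ccvg_dot x z)) (ccvg_dot y z).
by congr ccvg; apply/funext => n; rewrite -dotsDl.
Qed.

Lemma dotC x y : dot y x = ((dot x y)^*)%C.
Proof.
apply: ccvg_unique (ccvg_dot _ _) _.
by have := ccvg_conj (ccvg_dot x y); congr ccvg; apply/funext => n; rewrite -dotsC.
Qed.

Definition dotl y x := dot x y.

HB.instance Definition _ y :=
  GRing.isLinear.Build C ell2 C *%R (dotl y) (dotP y).

Lemma dotDl x y z : dot (x + y) z = dot x z + dot y z.
Proof. exact: (raddfD (dotl z)). Qed.
Lemma dotBl x y z : dot (x - y) z = dot x z - dot y z.
Proof. exact: (raddfB (dotl z)). Qed.
Lemma dotZl a x z : dot (a *: x) z = a * dot x z.
Proof. exact: (scalarZ (dotl z)). Qed.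
Lemma dot0l z : dot 0 z = 0. Proof. exact: (raddf0 (dotl z)). Qed.
Lemma dot_suml I r (P : pred I) (F : I -> ell2) z :
  dot (\sum_(i <- r | P i) F i) z = \sum_(i <- r | P i) dot (F i) z.
Proof. exact: (raddf_sum (dotl z)). Qed.
Lemma dotDr x y z : dot z (x + y) = dot z x + dot z y.
Proof. by rewrite ![dot z _]dotC -rmorphD dotDl. Qed.
Lemma dotBr x y z : dot z (x - y) = dot z x - dot z y.
Proof. by rewrite ![dot z _]dotC -rmorphB dotBl. Qed.
Lemma dotZr a x z : dot z (a *: x) = a^*%C * dot z x.
Proof. by rewrite ![dot z _]dotC dotZl rmorphM. Qed.
Lemma dot0r z : dot z 0 = 0. Proof. by rewrite dotC dot0l conjc0. Qed.
Lemma dot_sumr I r (P : pred I) (F : I -> ell2) z :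
  dot z (\sum_(i <- r | P i) F i) = \sum_(i <- r | P i) dot z (F i).
Proof.
by rewrite dotC dot_suml rmorph_sum; apply: eq_bigr => i _; rewrite [RHS]dotC.
Qed.

Lemma dot_norm x : dot x x = (ell2_norm x ^+ 2)%:C%C.
Proof.
apply: ccvg_unique (ccvg_dot _ _) _; split => /=.
  by under eq_fun do rewrite dots_diag /=; exact: cvg_sqsum.
by under eq_fun do rewrite dots_diag /=; exact: cvg_cst.
Qed.

Lemma normc_le_norm x n : normc (x n) <= ell2_norm x.
Proof.
rewrite -ler_sqr ?nnegrE ?ell2_norm_ge0 ?normc_ge0//.
apply: le_trans (sqsum_le_norm x n.+1).
rewrite /sqsum /series /= big_nat_recr//= lerDr sumr_ge0// => i _.
exact: sqr_ge0.
Qed.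

Lemma ell2_norm_eq0 x : (ell2_norm x == 0) = (x == 0).
Proof.
apply/eqP/eqP => [x0|->].
  apply/val_inj/funext => n /=; apply: eq0_normc; apply/eqP.
  by rewrite eq_le normc_ge0 -x0 normc_le_norm.
apply/eqP; rewrite -sqrf_eq0; apply/eqP; apply: (@complexI R).
by rewrite -dot_norm dot0l.
Qed.

Lemma ell2_normZ a x : ell2_norm (a *: x) = normc a * ell2_norm x.
Proof.
apply/eqP; rewrite -(@eqrXn2 _ 2) ?mulr_ge0 ?ell2_norm_ge0 ?normc_ge0//; apply/eqP.
apply: (@complexI R); rewrite -dot_norm dotZl dotZr mulrA mul_conjc dot_norm.
by rewrite -rmorphM exprMn.
Qed.

Lemma ell2_norm0 : ell2_norm (0 : ell2) = 0.
Proof. by apply/eqP; rewrite ell2_norm_eq0. Qed.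

Lemma cauchy_schwarz x y : normc (dot x y) <= ell2_norm x * ell2_norm y.
Proof.
have [->|y0] := eqVneq y 0.
  by rewrite dot0r normc0 ell2_norm0 mulr0.
have ny : 0 < ell2_norm y by rewrite lt_def ell2_norm_eq0 y0 ell2_norm_ge0.
rewrite -ler_sqr ?nnegrE ?mulr_ge0 ?ell2_norm_ge0 ?normc_ge0// exprMn.
set N := ell2_norm y ^+ 2; have N0 : 0 < N by rewrite exprn_gt0.
(* This vector is [N] times the component of [x] orthogonal to [y]; the factor [N] avoids
   division. *)
have := sqr_ge0 (ell2_norm ((N%:C)%C *: x - dot x y *: y)).
rewrite -lecR -dot_norm dotBl !dotBr !dotZl !dotZr !dot_norm (dotC x y) conjc_real.
have -> : (N%:C * (N%:C * (ell2_norm x ^+ 2)%:C)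
    - N%:C * ((dot x y)^* * dot x y)
    - (dot x y * (N%:C * (dot x y)^*)
       - dot x y * ((dot x y)^* * (ell2_norm y ^+ 2)%:C)) =
    N%:C * (N%:C * (ell2_norm x ^+ 2)%:C - dot x y * (dot x y)^*))%C.
  by rewrite -/N; ring.
rewrite mul_conjc -!(rmorphM, rmorphB) lecR pmulr_rge0// subr_ge0.
by rewrite mulrC.
Qed.

Lemma ell2_normD x y : ell2_norm (x + y) <= ell2_norm x + ell2_norm y.
Proof.
rewrite -ler_sqr ?nnegrE ?addr_ge0 ?ell2_norm_ge0//.
have : (ell2_norm (x + y) ^+ 2)%:C%C = (ell2_norm x ^+ 2 + ell2_norm y ^+ 2 +
    (complex.Re (dot x y)) *+ 2)%:C%C.
  rewrite -dot_norm dotDl !dotDr !dot_norm (dotC x y).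
  by case: (dot x y) => p q; apply/eqP; rewrite eq_complex /=; apply/andP;
    split; apply/eqP; ring.
move/complexI => ->; rewrite sqrrD [leRHS]addrAC lerD2l ler_wMn2r//.
exact: le_trans (ler_norm _) (le_trans (abs_Re_le _) (cauchy_schwarz _ _)).
Qed.

Lemma dot_eq0 x : (forall y, dot y x = 0) -> x = 0.
Proof.
move=> /(_ x); rewrite dot_norm => /complexI/eqP.
by rewrite sqrf_eq0 ell2_norm_eq0 => /eqP.
Qed.

Lemma dot_inj x y : (forall z, dot z x = dot z y) -> x = y.
Proof.
by move=> xy; apply/eqP; rewrite -subr_eq0; apply/eqP/dot_eq0 => z;
  rewrite dotBr xy subrr.
Qed.

Lemma dot_basisr x n : dot x (ell2_basis R n) = x n.
Proof.
apply: ccvg_unique (ccvg_dot _ _) _.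
have E m : (n < m)%N -> dots x (ell2_basis R n) m = x n.
  move=> nm; rewrite /dots (bigD1 (Ordinal nm)) //= eqxx conjc1 mulr1.
  rewrite big1 ?addr0// => i; rewrite -val_eqE /= => /negPf ->.
  by rewrite conjc0 mulr0.
split; apply: cvg_near_cst; exists n.+1 => // m nm; rewrite E//.
Qed.

Lemma norm_basis n : ell2_norm (ell2_basis R n) = 1.
Proof.
apply/eqP; rewrite -(@eqrXn2 _ 2 _ 1) ?ell2_norm_ge0 ?ler01// expr1n; apply/eqP.
by apply: (@complexI R); rewrite -dot_norm dot_basisr /= eqxx.
Qed.

(** * Truncations, Riesz representation and adjoints *)

Definition trunc u N : ell2 := \sum_(i < N) u i *: ell2_basis R i.

Lemma trunc_at u N n : trunc u N n = if (n < N)%N then u n else 0.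
Proof.
rewrite -dot_basisr dot_suml.
case: ltnP => nN.
  rewrite (bigD1 (Ordinal nN)) //= big1 => [|i].
    by rewrite dotZl dot_basisr /= eqxx mulr1 addr0.
  rewrite -val_eqE /= eq_sym => /negPf ni.
  by rewrite dotZl dot_basisr /= ni mulr0.
rewrite big1// => i _; rewrite dotZl dot_basisr /=.
by rewrite (gtn_eqF (leq_trans (ltn_ord i) nN)) mulr0.
Qed.

Lemma dot_trunc u N x : dot (trunc u N) x = dots u x N.
Proof.
rewrite dot_suml; apply: eq_bigr => i _; rewrite dotZl.
by rewrite dotC dot_basisr.
Qed.

Lemma norm_trunc u N : ell2_norm (trunc u N) ^+ 2 = sqsum u N.
Proof.
apply: (@complexI R); rewrite -dot_norm dot_trunc -dots_diag.
by apply: eq_bigr => i _; rewrite trunc_at ltn_ord.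
Qed.

Lemma dist_trunc x N : ell2_norm (x - trunc x N) ^+ 2 = ell2_norm x ^+ 2 - sqsum x N.
Proof.
have E : dot (trunc x N) x = (sqsum x N)%:C%C by rewrite dot_trunc dots_diag.
apply: (@complexI R); rewrite -dot_norm dotBl !dotBr [dot x (trunc _ _)]dotC.
by rewrite E !dot_norm norm_trunc conjc_real subrr subr0 rmorphB.
Qed.

Lemma cvg_trunc x : ell2_norm (x - trunc x N) @[N --> \oo] --> 0.
Proof.
have -> : (fun N => ell2_norm (x - trunc x N)) =
          (fun N => Num.sqrt (ell2_norm x ^+ 2 - sqsum x N)).
  apply/funext => N; rewrite -dist_trunc sqrtr_sqr ger0_norm//.
  exact: ell2_norm_ge0.
rewrite -[X in _ --> X]sqrtr0; apply: continuous_cvg; first exact: sqrt_continuous.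
rewrite -[X in _ --> X](subrr (ell2_norm x ^+ 2)); apply: cvgB; first exact: cvg_cst.
exact: cvg_sqsum.
Qed.

(** The coordinates of the representing vector are the conjugates of [phi (ell2_basis R n)];
    boundedness of [phi] passes from truncations to the limit. *)
Lemma riesz (phi : ell2 -> C) (M : R) : scalar phi ->
  (forall x, normc (phi x) <= M * ell2_norm x) ->
  exists y, forall x, phi x = dot x y.
Proof.
move=> lphi phiM.
pose f : {scalar ell2} := HB.pack phi (GRing.isLinear.Build _ _ _ _ phi lphi).
have fZ a x : phi (a *: x) = a * phi x := scalarZ f a x.
pose c n : C := (phi (ell2_basis R n))^*%C.
have phi_trunc u N : phi (trunc u N) = dots u c N.
  apply: etrans (raddf_sum f _ _ _) _; apply: eq_bigr => i _.
  by rewrite [LHS]fZ /c conjcK.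
have cs : c \in @square_summable R.
  apply/square_summableP; exists (M ^+ 2) => N.
  (* Testing [phi] on the truncation of [c] itself gives s <= M sqrt(s) for s = [sqsum c N], hence s
     <= M^2. *)
  have := phiM (trunc c N); rewrite phi_trunc dots_diag normc_real.
  have s0 : 0 <= sqsum c N by rewrite -norm_trunc sqr_ge0.
  rewrite (ger0_norm s0) -{1}norm_trunc expr2.
  have := ell2_norm_ge0 (trunc c N); rewrite le_eqVlt => /orP[/eqP e _|p].
    by rewrite -norm_trunc -e expr0n sqr_ge0.
  rewrite ler_pM2r// => h; rewrite -norm_trunc ler_sqr ?nnegrE//.
    exact: ltW.
  exact: le_trans (ltW p) h.
exists (Ell2 cs) => x; apply: ccvg_unique (ccvg_dot x (Ell2 cs)).
apply: (@ccvg_squeeze _ _ (fun N => `|M| * ell2_norm (x - trunc x N))).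
  move=> N /=; have -> : dots x c N - phi x = - phi (x - trunc x N).
    rewrite -phi_trunc -opprB; congr (- _).
    exact: esym (raddfB f _ _).
  rewrite (normcN (phi _)); apply: le_trans (phiM _) _.
  by rewrite ler_wpM2r ?ell2_norm_ge0 ?ler_norm.
by rewrite -[X in _ --> X](mulr0 `|M|); apply: cvgMr; exact: cvg_trunc.
Qed.

Lemma bop_linear T : linear T.
Proof. by have /bounded_linearP[] := bop_bounded T. Qed.

HB.instance Definition _ T :=
  GRing.isLinear.Build C ell2 ell2 *:%R (bop_fun T) (bop_linear T).

Lemma bop_comb T a b x y : T (a *: x + b *: y) = a *: T x + b *: T y.
Proof. by rewrite linearP linearZ. Qed.

Lemma bopD T x y : T (x + y) = T x + T y.
Proof. exact: linearD. Qed.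

Lemma bopZ T a x : T (a *: x) = a *: T x.
Proof. exact: linearZ. Qed.

Lemma bop_bound T : exists2 M : R, 0 <= M & forall x, ell2_norm (T x) <= M * ell2_norm x.
Proof.
have /bounded_linearP[_ [M TM]] := bop_bounded T.
exists `|M| => // x; apply: le_trans (TM x) _.
by rewrite ler_wpM2r ?ell2_norm_ge0 ?ler_norm.
Qed.

Lemma ex_adjoint T : exists T' : bop, forall x y, dot (T x) y = dot x (T' y).
Proof.
have [M M0 TM] := bop_bound T.
have h y : exists y', forall x, dot (T x) y = dot x y'.
  apply: (@riesz _ (M * ell2_norm y)) => [a u v|x].
    by rewrite linearP dotP.
  apply: le_trans (cauchy_schwarz _ _) _.
  by rewrite mulrAC ler_wpM2r ?ell2_norm_ge0.
have [S TS] := choice h.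
have Sb : S \in @bounded_linear R.
  apply/bounded_linearP; split=> [a y z|].
    apply: dot_inj => x; rewrite -TS dotDr dotZr dotDr dotZr.
    by rewrite !TS.
  (* Here |Sy|^2 = <TSy, y> <= M |Sy| |y|, and a nonzero |Sy| cancels. *)
  exists M => y; have := ell2_norm_ge0 (S y); rewrite le_eqVlt => /orP[/eqP <-|p].
    by rewrite mulr_ge0 ?ell2_norm_ge0.
  rewrite -(ler_pM2r p) -expr2.
  have := cauchy_schwarz (T (S y)) y.
  rewrite TS dot_norm normc_real ger0_norm ?sqr_ge0// => /le_trans; apply.
  by rewrite mulrAC ler_wpM2r ?ell2_norm_ge0.
by exists (Bop Sb) => x y; rewrite TS.
Qed.

Definition adj T : bop := projT1 (cid (ex_adjoint T)).

Lemma dot_adjr T x y : dot x (adj T y) = dot (T x) y.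
Proof. by rewrite /adj; case: cid => S /= ->. Qed.

Lemma dot_adjl T x y : dot (adj T x) y = dot x (T y).
Proof. by rewrite dotC dot_adjr -dotC. Qed.

(** Coordinate i of T x is the inner product of x with T* e_i, whose coordinates only involve the T
    e_n; adjoints thus replace a density argument. *)
Lemma bop_ext (S T : bop) :
  (forall n, S (ell2_basis R n) = T (ell2_basis R n)) -> S = T.
Proof.
move=> ST; apply/val_inj/funext => x; apply/val_inj/funext => i /=.
rewrite -!dot_basisr -!dot_adjr; congr dot; apply/val_inj/funext => n /=.
by rewrite -!dot_basisr !dot_adjl ST.
Qed.

Lemma ell2ZE a x n : (a *: x) n = a * x n. Proof. by []. Qed.

Lemma bop_entries_ext (S T : bop) :
  (forall i j, S (ell2_basis R j) i = T (ell2_basis R j) i) -> S = T.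
Proof. by move=> ST; apply: bop_ext => j; apply/val_inj/funext => i; exact: ST. Qed.

End InnerProduct.

Arguments dot {R} x y : simpl never.

(** * Matrix entries of operators in Gamma *)

Section GammaEntries.
Variable R : realType.
Local Notation C := R[i].
Local Notation bop := (bop R).
Local Notation e_ := (ell2_basis R).

Lemma diagU_at (a : linf R) (g : emb) j i :
  (diag a * U_ R g) (e_ j) i = if g j == Some i then a i else 0.
Proof.
have -> : (diag a * U_ R g) (e_ j) = diag a (U_ R g (e_ j)) by [].
rewrite U_basis /=; case: (g j) => [k|] /=; last by rewrite mulr0.
rewrite (inj_eq (@Some_inj _)) eq_sym; case: eqVneq => _; rewrite ?mulr1//.
by rewrite mulr0.
Qed.

Fact entries_bounded (T : bop) (g : emb) :
  (fun i => oapp (fun j => T (e_ j) i) 0 (emb_inv g i)) \in @bounded_seq R.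
Proof.
have [M M0 TM] := bop_bound T.
apply/bounded_seqP; exists M => i; case: (emb_inv g i) => [j|] /=; last first.
  by rewrite normc0.
apply: le_trans (normc_le_norm _ _) _; apply: le_trans (TM _) _.
by rewrite norm_basis mulr1.
Qed.

Definition entries (T : bop) (g : emb) : linf R := Linf (entries_bounded T g).

Lemma diag_entriesU (T : bop) (g : emb) j i :
  (diag (entries T g) * U_ R g) (e_ j) i = if g j == Some i then T (e_ j) i else 0.
Proof.
rewrite diagU_at; case: eqP => // /emb_inv_funP gj.
by rewrite /entries /= gj.
Qed.

Lemma I_diagU (S : set (linf R)) a g : S a -> I_ S (diag a * U_ R g).
Proof.
move=> Sa; exists 1%N, (fun=> 1), (fun=> diag a * U_ R g); split.
  by move=> _; exists a => //; exists g.
by rewrite big_ord1 scale1r.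
Qed.

Lemma I_lin (S : set (linf R)) c x y : I_ S x -> I_ S y -> I_ S (c *: x + y).
Proof.
move=> [m [a [v [Sv ->]]]] [n [b [w [Sw ->]]]].
exists (m + n)%N, (fun i => match fintype.split i with inl j => c * a j | inr j => b j end),
  (fun i => match fintype.split i with inl j => v j | inr j => w j end).
split=> [i|]; first by case: (fintype.split i).
rewrite big_split_ord /= scaler_sumr; congr (_ + _); apply: eq_bigr => i _.
  by have := unsplitK (inl i : 'I_m + 'I_n) => /= ->; rewrite scalerA.
by have := unsplitK (inr i : 'I_m + 'I_n) => /= ->.
Qed.

Lemma I_0 (S : set (linf R)) : I_ S 0.
Proof. by exists 0%N, (fun=> 0), (fun=> 0); split; [case|rewrite big_ord0]. Qed.

Lemma I_D (S : set (linf R)) x y : I_ S x -> I_ S y -> I_ S (x + y).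
Proof. by move=> Sx Sy; rewrite -[x]scale1r; exact: I_lin. Qed.

(** The first hypothesis makes the graph of [f] disjoint from the diagonal, so that no entry is
    counted twice in the sum of the two bands. *)
Lemma Gamma_two_band (T : bop) (f : emb) : (forall j, f j <> Some j) ->
  (forall i j, i <> j -> f j <> Some i -> T (e_ j) i = 0) -> Gamma R T.
Proof.
move=> fn T0.
have -> : T = diag (entries T emb_id) * U_ R emb_id + diag (entries T f) * U_ R f.
  apply: bop_entries_ext => i j.
  transitivity ((diag (entries T emb_id) * U_ R emb_id) (e_ j) i +
    (diag (entries T f) * U_ R f) (e_ j) i); last by [].
  rewrite !diag_entriesU /= (inj_eq (@Some_inj _)).
  have [<-|/eqP ji] := eqVneq j i.
    by case: eqP => [/fn//|_]; rewrite addr0.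
  case: eqP => [_|fji]; rewrite ?addr0 ?add0r// T0// => ij.
  exact/ji/esym.
by apply: I_D; exact: I_diagU.
Qed.

End GammaEntries.

(** * Lanczos bidiagonalization *)

Section OrthogonalFamilies.
Variable R : realType.
Local Notation C := R[i].
Local Notation ell2 := (ell2 R).
Local Notation bop := (bop R).
Local Notation e_ := (ell2_basis R).

(* Each vector is a unit vector or zero, so that families can always be indexed
   by all of [nat]. *)
Definition orthofam (v : nat -> ell2) :=
  (forall i j, i <> j -> dot (v i) (v j) = 0) /\
  (forall i, dot (v i) (v i) *: v i = v i).

(** The partial projection w of h satisfies <h, w> = |w|^2, so Cauchy-Schwarz gives |w| <= |h|. *)
Lemma bessel (v : nat -> ell2) h N : orthofam v ->
  sqsum (fun i => dot h (v i)) N <= ell2_norm h ^+ 2.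
Proof.
move=> [vo v1]; pose c i := dot h (v i).
pose w : ell2 := \sum_(i < N) c i *: v i.
have hw : dot h w = (sqsum c N)%:C%C.
  rewrite /w dot_sumr -dots_diag; apply: eq_bigr => i _.
  by rewrite dotZr mulrC.
have ww : dot w w = (sqsum c N)%:C%C.
  rewrite -dots_diag /w dot_suml; apply: eq_bigr => i _.
  rewrite dotZl dot_sumr (bigD1 i)//= big1 ?addr0 => [|j ji].
    rewrite dotZr; congr (_ * _).
    (* The normalization absorbs the factor [dot (v i) (v i)], whether it is 1 or 0. *)
    have := congr1 (fun t => (dot h t)^*%C) (v1 i).
    by rewrite dotZr conjcM conjcK mulrC.
  by rewrite dotZr vo ?mulr0// => /val_inj ij; rewrite ij eqxx in ji.
have s0 : 0 <= sqsum c N by rewrite -norm_trunc sqr_ge0.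
have e : ell2_norm w ^+ 2 = sqsum c N by apply: (@complexI R); rewrite -dot_norm.
have := cauchy_schwarz h w; rewrite hw normc_real ger0_norm// -e.
have := ell2_norm_ge0 w; rewrite le_eqVlt => /orP[/eqP <- _|p].
  by rewrite expr0n sqr_ge0.
rewrite expr2 ler_pM2r// => wh.
by rewrite -expr2 ler_sqr ?nnegrE// ?ell2_norm_ge0.
Qed.

(** [V] is a partial isometry: its adjoint sends [e_ i] to [v i], and [adj V * V] is the orthogonal
    projection onto the closed span of [v]. *)
Lemma ex_analysis (v : nat -> ell2) : orthofam v ->
  exists V : bop, forall h i, V h i = dot h (v i).
Proof.
move=> vo.
have vs h : (fun i => dot h (v i)) \in @square_summable R.
  by apply/square_summableP; exists (ell2_norm h ^+ 2) => N; exact: bessel.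
have Vb : (fun h => Ell2 (vs h)) \in @bounded_linear R.
  apply: (@bounded_linearW _ _ 1) => [a x y|x n]; last first.
    by rewrite mul1r; exact: bessel.
  by apply/val_inj/funext => i /=; rewrite fctE dotP.
by exists (Bop Vb).
Qed.

Section Analysis.
Variables (v : nat -> ell2) (V : bop).
Hypotheses (vo : orthofam v) (VE : forall h i, V h i = dot h (v i)).

Lemma adj_analysis i : adj V (e_ i) = v i.
Proof. by apply: dot_inj => x; rewrite dot_adjr dot_basisr VE. Qed.

Lemma analysis_fam i : V (v i) = dot (v i) (v i) *: e_ i.
Proof.
apply/val_inj/funext => j; rewrite /= VE fctE /=.
have [->|/eqP ji] := eqVneq j i; first by rewrite [RHS]mulr1.
by rewrite vo.1 ?[RHS]mulr0// => ij; exact/ji/esym.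
Qed.

Lemma analysis_proj i : (adj V * V) (v i) = v i.
Proof.
have -> : (adj V * V) (v i) = adj V (V (v i)) by [].
by rewrite analysis_fam linearZ /= adj_analysis vo.2.
Qed.

Lemma dot_proj_eq0 h w : (forall i, dot w (v i) = 0) -> dot ((adj V * V) h) w = 0.
Proof.
move=> wv; have -> : (adj V * V) h = adj V (V h) by [].
rewrite dot_adjl; have -> : V w = 0.
  by apply/val_inj/funext => i; rewrite /= VE wv.
by rewrite dot0r.
Qed.

Lemma dot_proj h i : dot ((adj V * V) h) (v i) = dot h (v i).
Proof.
have -> : (adj V * V) h = adj V (V h) by [].
by rewrite dot_adjl -dot_adjr -[in RHS]analysis_proj.
Qed.

End Analysis.

Definition normalize (w : ell2) : ell2 := ((ell2_norm w)^-1%:C)%C *: w.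

Lemma normalizeK w : ((ell2_norm w)%:C)%C *: normalize w = w.
Proof.
have [->|w0] := eqVneq w 0; first by rewrite /normalize !scaler0.
by rewrite scalerA -rmorphM divff ?scale1r// ell2_norm_eq0.
Qed.

Lemma normalize_dot w : dot (normalize w) (normalize w) *: normalize w = normalize w.
Proof.
have [->|w0] := eqVneq w 0; first by rewrite /normalize !scaler0.
suff -> : dot (normalize w) (normalize w) = 1 by rewrite scale1r.
have n0 : ell2_norm w != 0 by rewrite ell2_norm_eq0.
rewrite dotZl dotZr conjc_real dot_norm -!rmorphM /=.
by have -> : (ell2_norm w)^-1 * ((ell2_norm w)^-1 * ell2_norm w ^+ 2) = 1 by field.
Qed.

End OrthogonalFamilies.

(** * The Lanczos recursion and the decomposition into Krylov spaces *)

Section Lanczos.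
Variable R : realType.
Local Notation C := R[i].
Local Notation ell2 := (ell2 R).
Local Notation bop := (bop R).
Local Notation e_ := (ell2_basis R).
Variable x : bop.

Definition alt k : bop := if odd k then adj x else x.

Lemma alt_adj k l g h : odd l = ~~ odd k -> dot (alt k g) h = dot g (alt l h).
Proof.
rewrite /alt => ->; case: (odd k) => /=; first by rewrite dot_adjl.
by rewrite dot_adjr.
Qed.

(* The pair of the (k-1)-st and k-th Lanczos vectors; the even ones live in the
   domain of [x], the odd ones in its codomain. *)
Fixpoint lanczos_pair z k : ell2 * ell2 :=
  if k is k'.+1 then
    let: (p, w) := lanczos_pair z k' in
    (w, normalize (alt k' w - dot (alt k' w) p *: p))
  else (0, normalize z).

Definition lanczos z k := (lanczos_pair z k).2.
Definition lanczos_prev z k := (lanczos_pair z k).1.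

Lemma lanczos_prevS z k : lanczos_prev z k.+1 = lanczos z k.
Proof. by rewrite /lanczos_prev /lanczos /=; case: lanczos_pair. Qed.

Lemma lanczosS z k : lanczos z k.+1 = normalize (alt k (lanczos z k) -
  dot (alt k (lanczos z k)) (lanczos_prev z k) *: lanczos_prev z k).
Proof. by rewrite /lanczos_prev /lanczos /=; case: lanczos_pair. Qed.

Lemma lanczos_normalized z k :
  dot (lanczos z k) (lanczos z k) *: lanczos z k = lanczos z k.
Proof. by case: k => [|k]; rewrite ?lanczosS normalize_dot. Qed.

(** Three-term recurrence; if the residual vanishes, its norm serves as a zero coefficient. *)
Lemma lanczos_rec z k : exists a b, alt k (lanczos z k) =
  a *: lanczos z k.+1 + b *: lanczos_prev z k.
Proof.
rewrite lanczosS; set b := dot _ _; set w := _ - _.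
by exists (ell2_norm w)%:C%C, b; rewrite normalizeK subrK.
Qed.

(** For the step from k to k+1: if l = k-1, the subtracted term cancels the inner product. If l <
    k-1, moving the operator onto vector l leaves vectors l+1 and l-1, both orthogonal to vector k
    by induction. *)
Lemma lanczos_orth z k l : (l < k)%N -> odd k = odd l ->
  dot (lanczos z k) (lanczos z l) = 0.
Proof.
elim/ltn_ind: k l => -[//|k] IH l lk kl.
rewrite lanczosS dotZl dotBl dotZl.
have {}lk : (l < k)%N.
  by rewrite ltnS leq_eqVlt in lk; case/orP: lk => // /eqP lk; move: kl;
    rewrite lk /=; case: odd.
case: k => // k in IH kl lk *; rewrite lanczos_prevS.
rewrite ltnS leq_eqVlt in lk; case/orP: lk => [/eqP ->|lk].
  have := lanczos_normalized z k; set d := dot (lanczos z k) _ => dk.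
  have -> : dot (alt k.+1 (lanczos z k.+1)) (lanczos z k) * d =
      dot (alt k.+1 (lanczos z k.+1)) (lanczos z k).
    rewrite -{2}dk dotZr mulrC; congr (_ * _).
    by rewrite /d dot_norm conjc_real.
  by rewrite subrr mulr0.
rewrite (IH k _ l)//; last first.
  by move: kl => /=; rewrite negbK.
rewrite mulr0 subr0 (@alt_adj _ l _ (lanczos z l)); last by rewrite -kl /= !negbK.
have [a [b ->]] := lanczos_rec z l.
rewrite dotDr !dotZr IH//=; last first.
  by move: kl => /= <-; rewrite !negbK.
rewrite mulr0 add0r; case: l => [|l] in kl lk *.
  by rewrite dot0r !mulr0.
have lk' : (l < k.+1)%N by lia.
rewrite lanczos_prevS IH ?mulr0//.
by move: kl => /= /negb_inj.
Qed.

(** Only even vectors of the second chain are tested, since they share the space of [z]. Moving the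
    operator across lowers k by one, so the induction carries the current and the previous vector
    together. *)
Lemma lanczos_cross z z' : (forall i, dot z (lanczos z' i.*2) = 0) ->
  forall k l, odd k = odd l -> dot (lanczos z k) (lanczos z' l) = 0.
Proof.
move=> z0 k; suff [] : (forall l, odd k = odd l -> dot (lanczos z k) (lanczos z' l) = 0) /\
    (forall l, odd l = ~~ odd k -> dot (lanczos_prev z k) (lanczos z' l) = 0) by [].
elim: k => [|k [IH1 IH2]]; split=> l kl; last 2 first.
- rewrite lanczosS dotZl dotBl dotZl IH2; last by rewrite -kl.
  rewrite mulr0 subr0 (@alt_adj _ l _ (lanczos z' l))//.
  have [a [b ->]] := lanczos_rec z' l.
  rewrite dotDr !dotZr IH1; last by rewrite /= -kl /= negbK.
  rewrite mulr0 add0r; case: l => [|l] in kl *; first by rewrite dot0r !mulr0.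
  by rewrite lanczos_prevS IH1 ?mulr0//; move: kl => /= /negb_inj.
- by rewrite lanczos_prevS IH1// kl /= negbK.
- rewrite /lanczos dotZl -[l]odd_double_half -kl add0n z0 ?mulr0//.
- by rewrite dot0l.
Qed.

Lemma lanczos_orthofam z (b : bool) : orthofam (fun i => lanczos z (b + i.*2)).
Proof.
split=> [i j ij|i]; last exact: lanczos_normalized.
have o k : odd (b + k.*2) = b by rewrite oddD odd_double addbF oddb.
have [lt|gt|//] := ltngtP i j; last first.
  by apply: lanczos_orth; rewrite ?o// ltn_add2l ltn_double.
by rewrite dotC lanczos_orth ?conjc0 ?o// ltn_add2l ltn_double.
Qed.

Definition krylov z : bop :=
  projT1 (cid (ex_analysis (lanczos_orthofam z false))).

Lemma krylovE z h i : krylov z h i = dot h (lanczos z i.*2).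
Proof. by rewrite /krylov; case: cid => V /= ->. Qed.

(** The orthogonal projection onto the closed span of the even Lanczos vectors of [z]. *)
Definition kproj z : bop := adj (krylov z) * krylov z.

Fixpoint kprojs n : bop :=
  if n is n'.+1 then kprojs n' + kproj (e_ n' - kprojs n' (e_ n')) else 0.

(* The part of [e_ n] orthogonal to the first n Krylov spaces, so that [e_ n] lies
   in the closed span of the first n.+1 ones. *)
Definition start n : ell2 := e_ n - kprojs n (e_ n).

Lemma kprojsE n h : kprojs n h = \sum_(m < n) kproj (start m) h.
Proof.
elim: n => [|n IH]; first by rewrite big_ord0.
by rewrite big_ord_recr /= -IH.
Qed.

(** Among the projections subtracted from [e_ n], the m-th alone has a component along the m-th
    chain, and it cancels that of [e_ n]; the others are orthogonal to that chain by induction. *)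
Lemma start_orth n m i : (m < n)%N -> dot (start n) (lanczos (start m) i.*2) = 0.
Proof.
elim/ltn_ind: n m i => n IH m i mn.
have P h : dot (kproj (start m) h) (lanczos (start m) i.*2) =
    dot h (lanczos (start m) i.*2).
  exact: (dot_proj (lanczos_orthofam _ false) (@krylovE _)).
rewrite {1}/start dotBl kprojsE dot_suml (bigD1 (Ordinal mn))//= P.
rewrite big1 ?addr0 ?subrr// => m' m'm.
apply: (dot_proj_eq0 (@krylovE (start m'))) => j.
have {m'm} : (m : nat) <> m' by move=> mm'; rewrite -val_eqE /= mm' eqxx in m'm.
move=> m'm; have [lt|gt|//] := ltngtP m m'.
  rewrite dotC lanczos_cross ?conjc0 ?odd_double// => k.
  exact: IH.
by apply: lanczos_cross; rewrite ?odd_double// => k; exact: IH.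
Qed.

Lemma start_lanczos_orth n m k l : n <> m -> odd k = odd l ->
  dot (lanczos (start n) k) (lanczos (start m) l) = 0.
Proof.
move=> nm kl; have [lt|gt|/esym/nm//] := ltngtP m n.
  by apply: lanczos_cross => // i; exact: start_orth.
by rewrite dotC lanczos_cross ?conjc0// => i; exact: start_orth.
Qed.

(** All chains in one family, indexed by the code of (chain, position): [b = false] gives the domain
    side, [b = true] the codomain side. Numbers that code no pair give the zero vector. *)
Definition lfam (b : bool) (n : nat) : ell2 :=
  if @pickle_inv (nat * nat)%type n is Some (m, i) then lanczos (start m) (b + i.*2)
  else 0.

Lemma lfam_pickle b m i : lfam b (pickle (m, i)) = lanczos (start m) (b + i.*2).
Proof. by rewrite /lfam pickleK_inv. Qed.

Lemma lfam_orth b : orthofam (lfam b).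
Proof.
split=> [i j ij|i]; last first.
  by rewrite /lfam; case: pickle_inv => [[m k]|]; rewrite ?scaler0 ?lanczos_normalized.
rewrite /lfam; have := @pickle_invK (nat * nat)%type i.
have := @pickle_invK (nat * nat)%type j.
case: pickle_inv => [[m k]|] /=; last by rewrite dot0r.
case: pickle_inv => [[m' k']|] /=; last by rewrite dot0l.
move=> hj hi; have [mm|mm] := pselect (m' = m); last first.
  by apply: start_lanczos_orth => //; rewrite !oddD !odd_double.
subst m'; apply: (lanczos_orthofam (start m) b).1 => kk.
by apply: ij; rewrite -hi -hj kk.
Qed.

(** The off-diagonal band: [x] sends vector 2i of a chain into the span of vectors 2i+1 and 2i-1,
    that is, of codomain positions i and i-1. *)
Definition down_fun (n : nat) : option nat :=
  if @pickle_inv (nat * nat)%type n is Some (m, i.+1) then Some (pickle (m, i))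
  else None.

Fact down_inj m n k : down_fun m = Some k -> down_fun n = Some k -> m = n.
Proof.
rewrite /down_fun.
have := @pickle_invK (nat * nat)%type m; have := @pickle_invK (nat * nat)%type n.
case: pickle_inv => [[a [|i]]|] //=.
case: pickle_inv => [[b [|j]]|] //= <- <- [<-] [/(pcan_inj pickleK)].
by move=> [-> ->].
Qed.

Definition down : emb := Emb down_inj.

Lemma lfam_step n : exists a b,
  x (lfam false n) = a *: lfam true n + b *: oapp (lfam true) 0 (down n).
Proof.
rewrite /lfam /= /down_fun; case: pickle_inv => [[m i]|]; last first.
  by exists 0, 0; rewrite linear0 !scale0r addr0.
have [a [b ab]] := lanczos_rec (start m) i.*2; exists a, b.
move: ab; rewrite /alt odd_double add0n => ->.
congr (_ + b *: _); case: i => [//|i].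
by rewrite doubleS lanczos_prevS /= pickleK_inv add1n.
Qed.

Lemma down_neq j : down j <> Some j.
Proof.
rewrite /= /down_fun; have := @pickle_invK (nat * nat)%type j.
case: pickle_inv => [[m [|i]]|] //= jE [] /esym; rewrite -{1}jE.
by move/(pcan_inj pickleK) => -[] /esym; apply/eqP; rewrite neq_ltn ltnSn.
Qed.

(** With analysis operators [V], [U] of the two families, take y = U x V*. Then x = U* y V, because
    V*V = 1 and U*U fixes the range of x V*. *)
Lemma bidiagonalization : exists2 y, Gamma R y & exists A B : bop, exists A' B' : bop,
  y = A * x * B /\ x = A' * y * B'.
Proof.
have [V VE] := ex_analysis (lfam_orth false).
have [U UE] := ex_analysis (lfam_orth true).
have VP := analysis_proj (lfam_orth false) VE.
have UP := analysis_proj (lfam_orth true) UE.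
have xV : adj U * U * (x * adj V) = x * adj V.
  apply: bop_ext => n.
  have -> : (x * adj V) (e_ n) = x (lfam false n).
    by rewrite -(adj_analysis VE).
  have -> : (adj U * U * (x * adj V)) (e_ n) = (adj U * U) (x (lfam false n)).
    by rewrite -(adj_analysis VE).
  have [a [b ->]] := lfam_step n; rewrite bop_comb UP.
  by case: (down n) => [k|]; rewrite ?UP// !linear0.
(* [e_ n] is [start n], a multiple of a vector of the family, plus its projections onto earlier
   Krylov spaces; V*V fixes both. *)
have VV : adj V * V = 1.
  apply: bop_ext => n; have -> : e_ n = start n + kprojs n (e_ n) by rewrite subrK.
  rewrite bopD; congr (_ + _).
    have -> : start n = (ell2_norm (start n))%:C%C *: lfam false (pickle (n, 0%N)).
      by rewrite lfam_pickle [lanczos _ _]/= normalizeK.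
    by rewrite bopZ VP.
  rewrite kprojsE linear_sum; apply: eq_bigr => m _.
  suff : adj V * V * adj (krylov (start m)) = adj (krylov (start m)).
    by move/(congr1 (fun T : bop => T (krylov (start m) (e_ n)))).
  apply: bop_ext => i.
  have -> : (adj V * V * adj (krylov (start m))) (e_ i) =
    (adj V * V) (adj (krylov (start m)) (e_ i)) by [].
  rewrite (adj_analysis (@krylovE _)).
  by have := VP (pickle (m : nat, i)); rewrite lfam_pickle.
exists (U * x * adj V); last first.
  exists U, (adj V), (adj U), V; split => //.
  by rewrite !mulrA -(mulrA _ x) xV -mulrA VV mulr1.
apply: (Gamma_two_band down_neq) => i j ij jd.
have -> : (U * x * adj V) (e_ j) = U (x (lfam false j)).
  by rewrite -(adj_analysis VE).
rewrite UE; have [a [b ->]] := lfam_step j; rewrite dotP dotZl.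
rewrite (lfam_orth true).1 => [|ji]; last exact/ij/esym.
case E: (down j) => [k|] /=; rewrite ?dot0l ?mulr0 ?addr0//.
by rewrite (lfam_orth true).1 ?mulr0 ?addr0// => ki; apply: jd; rewrite E ki.
Qed.

End Lanczos.

(** * Ideals of Gamma *)

(** Colour the integers in order: earlier neighbours exclude at most [D] of the [D.+1] colours. *)
Lemma greedy_colouring (D : nat) (nb : nat -> seq nat) :
  (forall n, size (nb n) <= D)%N ->
  exists c : nat -> 'I_D.+1, forall m n, (m < n)%N -> m \in nb n -> c m <> c n.
Proof.
move=> nbD.
have free (s : seq nat) : exists x, (x <= size s)%N /\ x \notin s.
  apply: contrapT => nx; suff : (size (iota 0 (size s).+1) <= size s)%N.
    by rewrite size_iota ltnn.
  apply: uniq_leq_size; first exact: iota_uniq.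
  move=> x; rewrite mem_iota add0n ltnS => /andP[_ xs].
  by apply: contrapT => /negP xns; apply: nx; exists x.
have [fr frP] := choice free.
(* Neighbours not yet coloured read as the default 0; this may exclude colour 0, but at most [D]
   colours stay excluded. *)
pose next n s := fr [seq nth 0%N s m | m <- nb n].
pose fix cols n := if n is n'.+1 then rcons (cols n') (next n' (cols n')) else [::].
have size_cols n : size (cols n) = n by elim: n => //= n IH; rewrite size_rcons IH.
pose c n := next n (cols n).
have colsE n m : (m < n)%N -> nth 0%N (cols n) m = c m.
  elim: n => // n IH mn /=; rewrite nth_rcons size_cols.
  have [mn'|nm] := ltnP m n; first exact: IH.
  have -> : m = n by apply/eqP; rewrite eqn_leq nm -ltnS mn.
  by rewrite eqxx.
have cD n : (c n < D.+1)%N.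
  by rewrite ltnS (leq_trans (frP _).1)// size_map.
exists (fun n => Ordinal (cD n)) => m n mn mnb [cmn].
have := (frP [seq nth 0%N (cols n) m | m <- nb n]).2.
by apply/negP; rewrite negbK; apply/mapP; exists m => //; rewrite colsE.
Qed.

(** The neighbours of j are the points f_l^{-1}(f_k(j)), at most n^2 of them. *)
Lemma emb_colouring (n : nat) (f : 'I_n -> emb) :
  exists D (c : nat -> 'I_D.+1), forall j j' k l i,
    f k j = Some i -> f l j' = Some i -> j <> j' -> c j <> c j'.
Proof.
pose nb j := pmap (fun p : 'I_n * 'I_n => obind (emb_inv (f p.2)) (f p.1 j))
  (enum {: 'I_n * 'I_n}).
have nbP j j' k l i : f k j = Some i -> f l j' = Some i -> j' \in nb j.
  move=> kj lj'; rewrite mem_pmap; apply/mapP; exists (k, l).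
    by rewrite mem_enum.
  by rewrite /= kj /=; apply/esym/emb_inv_funP.
have [|c cP] := @greedy_colouring (size (enum {: 'I_n * 'I_n})) nb.
  move=> j; rewrite size_pmap; apply: leq_trans (count_size _ _) _.
  by rewrite size_map.
exists _, c => j j' k l i kj lj' jj'; have [lt|gt|//] := ltngtP j j'.
  by apply: cP => //; apply: nbP lj' kj.
by apply/nesym; apply: cP => //; apply: nbP kj lj'.
Qed.

(** * Ideals of Gamma are determined by their diagonals *)

Section GammaIdeals.
Variable R : realType.
Local Notation C := R[i].
Local Notation bop := (bop R).
Local Notation e_ := (ell2_basis R).

Lemma bop_sumE I r (P : pred I) (F : I -> bop) h :
  (\sum_(i <- r | P i) F i) h = \sum_(i <- r | P i) F i h.
Proof. by elim/big_rec2: _ => // i x y _ <-. Qed.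

Lemma ell2_sumE I r (P : pred I) (F : I -> ell2 R) n :
  (\sum_(i <- r | P i) F i) n = \sum_(i <- r | P i) F i n.
Proof. by elim/big_rec2: _ => // i x y _ <-. Qed.

Lemma linf_sumE I r (P : pred I) (F : I -> linf R) n :
  (\sum_(i <- r | P i) F i) n = \sum_(i <- r | P i) F i n.
Proof. by elim/big_rec2: _ => // i x y _ <-. Qed.

Lemma I_sum (S : set (linf R)) J r (P : pred J) (F : J -> bop) :
  (forall i, P i -> I_ S (F i)) -> I_ S (\sum_(i <- r | P i) F i).
Proof. move=> IF; apply: big_ind => //; [exact: I_0|exact: I_D]. Qed.

Lemma Gamma_support (x : bop) : Gamma R x -> exists n (f : 'I_n -> emb),
  forall i j, x (e_ j) i != 0 -> exists k, f k j = Some i.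
Proof.
move=> [n [c [v [Ev ->]]]].
have h k : exists p : linf R * emb, v k = diag p.1 * U_ R p.2.
  by have [a _ [g _ <-]] := Ev k; exists (a, g).
have [p pE] := choice h; exists n, (fun k => (p k).2) => i j.
rewrite bop_sumE ell2_sumE => s0; apply: contrapT => nk; move/negP: s0; apply.
apply/eqP; apply: big1 => k _.
have -> : (c k *: v k) (e_ j) i = c k * v k (e_ j) i by [].
rewrite pE diagU_at; case: eqP => [kj|_]; last exact: mulr0.
by case: nk; exists k.
Qed.

(** [g] sends each nonzero column to the row of its entry. The second equation puts the diagonal
    into every ideal of Gamma that contains [y]. *)
Lemma monomial_bop (y : bop) :
  (forall i j j', y (e_ j) i != 0 -> y (e_ j') i != 0 -> j = j') ->
  (forall i i' j, y (e_ j) i != 0 -> y (e_ j) i' != 0 -> i = i') ->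
  exists g, y = diag (entries y g) * U_ R g /\
            diag (entries y g) = y * U_ R (emb_inv g).
Proof.
move=> ycol yrow.
pose gf j := if pselect (exists i, y (e_ j) i != 0) is left h
  then Some (xchoose h) else None.
have gfP j i : gf j = Some i <-> y (e_ j) i != 0.
  rewrite /gf; case: pselect => [h|nh]; last by split=> // ij; case: nh; exists i.
  have hc := xchooseP h; split=> [[<-]//|yi].
  by congr Some; exact: yrow hc yi.
have ginj m n k : gf m = Some k -> gf n = Some k -> m = n.
  by move=> /gfP mk /gfP nk; exact: ycol mk nk.
exists (Emb ginj); split.
  apply: bop_entries_ext => i j; apply/esym.
  rewrite [LHS]diag_entriesU; case: eqP => // /gfP/negP; rewrite negbK.
  by move/eqP.
apply: bop_entries_ext => l i.
have -> : (y * U_ R (emb_inv (Emb ginj))) (e_ i) =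
  y (U_ R (emb_inv (Emb ginj)) (e_ i)) by [].
rewrite U_basis diag_basis ell2ZE.
rewrite /=; case E: (emb_inv_fun (Emb ginj) i) => [j|] /=.
  case: eqVneq => [->|li]; first by rewrite mulr1.
  rewrite mulr0; apply/esym/eqP; apply: contraTT li => yl; rewrite negbK.
  have /emb_inv_funP/gfP yi := E.
  by apply/eqP; exact: yrow yl yi.
by rewrite mul0r linear0.
Qed.

Fact indic_bounded (P : pred nat) : (fun n => (P n)%:R : C) \in @bounded_seq R.
Proof.
apply/bounded_seqP; exists 1 => n; case: (P n); first by rewrite normc1.
by rewrite normc0.
Qed.

Definition indic_linf (P : pred nat) : linf R := Linf (indic_bounded P).

Lemma diag_lin c (a b : linf R) : diag (c *: a + b) = c *: diag a + diag b.
Proof.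
apply/val_inj/funext => x; apply/val_inj/funext => n.
by rewrite /= !fctE mulrDl -mulrA.
Qed.

Lemma diag0 : diag (0 : linf R) = 0.
Proof. by apply/val_inj/funext => x; apply/val_inj/funext => n; exact: mul0r. Qed.

Lemma sum_indic_linf D (c : nat -> 'I_D) :
  \sum_(p < D) indic_linf (fun n => c n == p) = 1.
Proof.
apply/val_inj/funext => n; rewrite [LHS]linf_sumE (bigD1 (c n))//=.
by rewrite eqxx big1 ?addr0// => p pc; rewrite eq_sym (negPf pc).
Qed.

Lemma sum_diag_indic D (c : nat -> 'I_D) :
  \sum_(p < D) diag (indic_linf (fun n => c n == p)) = 1.
Proof.
rewrite -diag1 -(sum_indic_linf c); apply/esym/big_morph => [a b|].
  by rewrite -[a]scale1r diag_lin !scale1r.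
exact: diag0.
Qed.

Lemma diag_push (f : emb) (a : linf R) :
  diag (push_linf f a) = U_ R f * diag a * U_ R (emb_inv f).
Proof.
rewrite U_diag -mulrA U_comp; apply: bop_entries_ext => i j.
rewrite diagU_at diag_basis ell2ZE.
rewrite /= /push /=; case: (eqVneq i j) => [->|ij].
  rewrite mulr1; case E: (emb_inv_fun f j) => [k|] //=.
  by have /emb_inv_funP -> := E; rewrite eqxx.
rewrite mulr0; case E: (emb_inv_fun f j) => [k|] //=.
have /emb_inv_funP -> := E; rewrite (inj_eq (@Some_inj _)) eq_sym.
by rewrite (negPf ij).
Qed.

Lemma Gamma_diag (a : linf R) : Gamma R (diag a).
Proof. by have := @I_diagU R setT a emb_id I; rewrite U_id mulr1. Qed.

Lemma Gamma_U (f : emb) : Gamma R (U_ R f).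
Proof. by have := @I_diagU R setT 1 f I; rewrite diag1 mul1r. Qed.

Definition diag_part (J : set bop) : set (linf R) := [set a | J (diag a)].

Lemma diag_part_ideal (J : set bop) : two_sided_ideal (Gamma R) J ->
  symmetric_ideal (diag_part J).
Proof.
move=> [JG J0 Jlin Jmul]; split; last first.
  move=> f _ [a Ja <-]; rewrite /diag_part /= diag_push.
  by apply: (Jmul _ _ (Gamma_U _) _).2; apply: (Jmul _ _ (Gamma_U _) Ja).1.
split => //.
- by rewrite /diag_part /= diag0.
- by move=> c a b Ja Jb; rewrite /diag_part /= diag_lin; exact: Jlin.
- by move=> b a _ Ja; rewrite /diag_part /= !diagM; exact: Jmul (Gamma_diag b) Ja.
Qed.

(* Colour the columns so that two columns meeting a common row get different
   colours, and the rows likewise: cutting x down to one row colour and one column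
   colour leaves at most one entry in each row and column. *)
Lemma Gamma_ideal_diag (J : set bop) : two_sided_ideal (Gamma R) J ->
  J = I_ (diag_part J).
Proof.
move=> [JG J0 Jlin Jmul]; apply/seteqP; split=> [x Jx|]; last first.
  move=> _ [n [c [v [Sv ->]]]].
  elim: n => [|n IH] in c v Sv *; first by rewrite big_ord0.
  rewrite big_ord_recl; apply: Jlin; last exact: IH.
  by have [a Ja [f _ <-]] := Sv ord0; apply: (Jmul _ _ (Gamma_U _) Ja).2.
have [n [f fP]] := Gamma_support (JG _ Jx).
have [D [c cP]] := emb_colouring f.
(* Colouring for the inverses separates rows that share a column. *)
have [D' [r rP]] := emb_colouring (fun k => emb_inv (f k)).
pose E p := diag (indic_linf (fun n => r n == p)).
pose F q := diag (indic_linf (fun n => c n == q)).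
have -> : x = (\sum_p E p) * x * (\sum_q F q).
  by rewrite !sum_diag_indic mul1r mulr1.
rewrite mulr_suml mulr_suml; apply: I_sum => p _.
rewrite mulr_sumr; apply: I_sum => q _.
have Jy : J (E p * x * F q).
  by apply: (Jmul _ _ (Gamma_diag _) _).2; apply: (Jmul _ _ (Gamma_diag _) Jx).1.
set y := E p * x * F q in Jy *.
have yE j i : y (e_ j) i = (r i == p)%:R * ((c j == q)%:R * x (e_ j) i).
  have -> : y (e_ j) i = (r i == p)%:R * x (F q (e_ j)) i by [].
  by rewrite diag_basis bopZ.
have y0 j i : y (e_ j) i != 0 -> [/\ r i = p, c j = q & exists k, f k j = Some i].
  rewrite yE !mulf_eq0 !negb_or !pnatr_eq0 !eqb0 !negbK.
  by move=> /and3P[/eqP ? /eqP ? /fP].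
have [||g [yg gy]] := @monomial_bop y.
- move=> i j j' /y0[_ cj [k kj]] /y0[_ cj' [l lj']].
  apply: contrapT => jj'; apply: (cP _ _ _ _ _ kj lj' jj').
  by rewrite cj cj'.
- move=> i i' j /y0[ri _ [k kj]] /y0[ri' _ [l lj]].
  apply: contrapT => ii'; apply: (rP i i' k l j _ _ ii'); last by rewrite ri ri'.
    exact/emb_inv_funP.
  exact/emb_inv_funP.
rewrite yg; apply: I_diagU; rewrite /diag_part /= gy.
exact: (Jmul _ _ (Gamma_U _) Jy).2.
Qed.

Lemma trace_ideal (J : set bop) : two_sided_ideal setT J ->
  two_sided_ideal (Gamma R) (J `&` Gamma R).
Proof.
move=> [_ J0 Jlin Jmul]; split.
- by move=> x [].
- by split => //; exact: I_0.
- by move=> c x y [Jx Gx] [Jy Gy]; split; [exact: Jlin|exact: I_lin].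
- move=> a x Ga [Jx Gx]; have [] := Jmul a x Logic.I Jx.
  by move=> ax xa; split; split => //; exact: GammaM.
Qed.

End GammaIdeals.

(** * Calkin's correspondence for diagonal operators *)

Definition emb_of (h : nat -> nat) (hi : injective h) : emb :=
  Emb (emb_fun := fun n => Some (h n)) (fun m n k hm hn =>
    hi m n (Some_inj (etrans hm (esym hn)))).

Lemma emb_inv_of h (hi : injective h) n : emb_inv (emb_of hi) (h n) = Some n.
Proof. exact/emb_inv_funP. Qed.

Lemma subsequence_ge (P : nat -> Prop) : (forall N, exists2 n, (N <= n)%N & P n) ->
  exists2 h : nat -> nat, injective h & forall k, P (h k).
Proof.
move=> /(_ _)/cid2-/all_sig2[g gN Pg].
pose fix h k := if k is k'.+1 then g (h k').+1 else g 0%N.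
exists h; last by case=> [|k]; exact: Pg.
have hlt : {homo h : i j / (i < j)%N} by apply: homo_ltn ltn_trans _ => k; exact: gN.
by move=> i j ij; have [/hlt|/hlt|//] := ltngtP i j; rewrite ij ltnn.
Qed.

(** * Decreasing rearrangement of null sequences *)

Section DecreasingEnumeration.
Variable R : realType.
Implicit Types w : nat -> R.

Definition vanishing w := forall eps, 0 < eps -> exists N, forall n, (N <= n)%N -> w n < eps.

Lemma exists_max_outside w (L : seq nat) : (forall n, 0 <= w n) -> vanishing w ->
  exists m, m \notin L /\ forall m', m' \notin L -> w m' <= w m.
Proof.
move=> w0 wv.
have [[m0 [m0L wm0]]|nm] := pselect (exists m, m \notin L /\ 0 < w m); last first.
  (* No positive value is left outside [L], so any fresh index is a maximum. *)
  exists (\max_(i <- L) i).+1; split.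
    by apply/negP => mL; have := @leq_bigmax_seq _ L xpredT id _ mL isT; rewrite ltnn.
  move=> m' m'L; apply: le_trans (w0 _); rewrite leNgt; apply/negP => wm'.
  by apply: nm; exists m'.
have [N wN] := wv _ wm0.
have m0N : (m0 < N)%N by rewrite ltnNge; apply/negP => /wN; rewrite ltxx.
pose i0 := Ordinal m0N.
have := @arg_maxP _ R 'I_N i0 (fun i : 'I_N => val i \notin L) (fun i => w i) m0L.
case=> i iL imax; exists (val i); split=> // m' m'L.
have [m'N|Nm'] := ltnP m' N; first exact: (imax (Ordinal m'N)).
exact: le_trans (ltW (wN _ Nm')) (imax i0 m0L).
Qed.

(** Pick a maximum among the remaining indices again and again. An index with positive value that is
    never picked would leave infinitely many values at least as large, which vanishing forbids. *)
Lemma decreasing_enumeration w : (forall n, 0 <= w n) -> vanishing w ->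
  exists s : nat -> nat, [/\ injective s,
    forall k m, m \notin [seq s i | i <- iota 0 k] -> w m <= w (s k) &
    forall m, 0 < w m -> exists k, s k = m].
Proof.
move=> w0 wv.
have [p pP] := choice (fun L => @exists_max_outside w L w0 wv).
pose fix L k := if k is k'.+1 then rcons (L k') (p (L k')) else [::].
pose s k := p (L k).
have LE k : L k = [seq s i | i <- iota 0 k].
  elim: k => [//|k IH].
  by rewrite -{2}[k.+1]addn1 iotaD map_cat -IH cats1.
have si : injective s.
  have sn i j : (i < j)%N -> s i <> s j.
    move=> ij sij; have := (pP (L j)).1; rewrite -/(s j) -sij LE.
    by move/negP; apply; apply: map_f; rewrite mem_iota.
  by move=> i j sij; have [/sn|/sn/nesym|//] := ltngtP i j.
have smax k m : m \notin [seq s i | i <- iota 0 k] -> w m <= w (s k).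
  by rewrite -LE; exact: (pP (L k)).2.
exists s; split=> // m wm; apply: contrapT => ns.
have ws k : w m <= w (s k).
  by apply: smax; apply/negP => /mapP[i _ mi]; apply: ns; exists i.
have [N wN] := wv _ wm.
have sN k : (s k < N)%N.
  by rewrite ltnNge; apply/negP => /wN; rewrite ltNge ws.
pose f (i : 'I_N.+1) := Ordinal (sN i).
have : injective f by move=> i j [] /si /val_inj.
by move/leq_card; rewrite !card_ord ltnn.
Qed.

End DecreasingEnumeration.

(** * Control of operators by sequences, and symmetric ideals *)

Section CalkinIdeals.
Variable R : realType.
Local Notation C := R[i].
Local Notation bop := (bop R).
Local Notation ell2 := (ell2 R).
Local Notation e_ := (ell2_basis R).

Lemma ell2_norm_dominated (x y : ell2) t : 0 <= t ->
  (forall n, normc (x n) <= t * normc (y n)) -> ell2_norm x <= t * ell2_norm y.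
Proof.
move=> t0 xy; have ty : 0 <= t * ell2_norm y by rewrite mulr_ge0 ?ell2_norm_ge0.
rewrite -(ger0_norm ty) -sqrtr_sqr; apply: ell2_norm_le => n.
rewrite exprMn; apply: le_trans (ler_wpM2l (sqr_ge0 t) (sqsum_le_norm y n)).
rewrite /sqsum /series /= mulr_sumr; apply: ler_sum => i _.
by rewrite -exprMn ler_sqr ?nnegrE ?mulr_ge0 ?normc_ge0.
Qed.

(* [x] is bounded by [t] on a subspace of codimension [K * size E] as soon as
   [w <= t] outside [E]: a substitute for bounds on singular values. *)
Definition controlled (w : nat -> R) (K : nat) (x : bop) :=
  forall (E : seq nat) (t : R), 0 <= t -> (forall m, m \notin E -> w m <= t) ->
  exists phi : 'I_(K * size E) -> ell2, forall v,
    (forall i, dot v (phi i) = 0) -> ell2_norm (x v) <= t * ell2_norm v.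

(** [M] linear conditions on more than [M] coefficients have a nonzero solution. *)
Lemma exists_orthogonal_comb N M (T : 'I_N -> nat) (phi : 'I_M -> ell2) :
  injective T -> (M < N)%N ->
  exists v : ell2, [/\ v != 0, forall n, (forall i, T i <> n) -> v n = 0 &
    forall i, dot v (phi i) = 0].
Proof.
move=> Ti MN.
pose A : 'M[C]_(N, M) := \matrix_(i, j) dot (e_ (T i)) (phi j).
have kA : kermx A != 0.
  rewrite -mxrank_eq0 mxrank_ker -lt0n subn_gt0.
  exact: leq_ltn_trans (rank_leq_col A) MN.
have [i [c cE c0]] : exists i, exists2 c : 'rV[C]_N, c = row i (kermx A) & c != 0.
  apply: contrapT => nr; case/negP: kA; apply/eqP/row_matrixP => i.
  rewrite row0; apply/eqP; apply: contrapT => /negP r0.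
  by apply: nr; exists i, (row i (kermx A)).
have cA : c *m A = 0 by rewrite cE -row_mul mulmx_ker row0.
pose v : ell2 := \sum_k c 0 k *: e_ (T k).
have vE n : v n = \sum_k c 0 k * (n == T k)%:R by rewrite ell2_sumE.
exists v; split.
- apply: contra c0 => /eqP v0; apply/eqP/rowP => k; rewrite mxE.
  have := vE (T k); rewrite v0 (bigD1 k)//= eqxx mulr1 big1 ?addr0 => [//|l lk].
  by rewrite (inj_eq Ti) eq_sym (negPf lk) mulr0.
- move=> n nT; rewrite vE big1// => k _; case: eqVneq => [nk|_]; rewrite ?mulr0//.
  by case: (nT k).
- move=> j; have := congr1 (fun B : 'rV[C]_M => B 0 j) cA.
  rewrite !mxE => <-; rewrite dot_suml; apply: eq_bigr => k _.
  by rewrite dotZl mxE.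
Qed.

(** Min-max argument: [diag a] is bounded below by [r] on the span of [N] basis vectors, which meets
    the controlled subspace of codimension less than [N] in a nonzero vector. *)
Lemma controlled_diag_le w K (a : linf R) N (T : 'I_N -> nat) (E : seq nat) (t r : R) :
  controlled w K (diag a) -> injective T -> (K * size E < N)%N ->
  0 <= t -> (forall m, m \notin E -> w m <= t) ->
  (forall i, r <= normc (a (T i))) -> r <= t.
Proof.
move=> wa Ti KN t0 wE ra; have [r0|r0] := leP r 0; first exact: le_trans t0.
have [phi phiP] := wa E t t0 wE.
have [v [v0 vT vphi]] := exists_orthogonal_comb phi Ti KN.
have vp : 0 < ell2_norm v by rewrite lt_def ell2_norm_eq0 v0 ell2_norm_ge0.
rewrite -(ler_pM2r vp); apply: le_trans (phiP v vphi).
rewrite -(ler_pM2l (_ : 0 < r^-1)) ?invr_gt0// mulrA mulVf ?gt_eqF// mul1r.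
apply: ell2_norm_dominated => [|n]; first by rewrite invr_ge0 ltW.
have [[i <-]|ni] := pselect (exists i, T i = n).
  rewrite [diag a v _]/= normcM ler_pdivlMl// ler_wpM2r ?normc_ge0//.
rewrite vT => [|i Tin]; last by apply: ni; exists i.
by rewrite normc0 mulr_ge0 ?normc_ge0// invr_ge0 ltW.
Qed.

Section SymmetricIdeal.
Variable S : set (linf R).
Hypothesis symS : symmetric_ideal S.

Lemma sym_lin c x y : S x -> S y -> S (c *: x + y).
Proof. by case: symS => -[_ _ h _] _; exact: h. Qed.

Lemma sym0 : S 0. Proof. by case: symS => -[]. Qed.

Lemma symD x y : S x -> S y -> S (x + y).
Proof. by move=> Sx Sy; rewrite -[x]scale1r; exact: sym_lin. Qed.

(** The quotient a/b is bounded and a = (a/b) b; where b vanishes, so does a, matching division by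
    zero. *)
Lemma sym_dominated (a b : linf R) (M : R) : S b ->
  (forall n, normc (a n) <= M * normc (b n)) -> S a.
Proof.
move=> Sb ab.
have qb : (fun n => a n / b n) \in @bounded_seq R.
  apply/bounded_seqP; exists `|M| => n; rewrite normcM normcV.
  have [bn|bn] := eqVneq (normc (b n)) 0; first by rewrite bn invr0 mulr0.
  rewrite ler_pdivrMr ?lt_def ?bn ?normc_ge0//.
  by apply: le_trans (ab n) _; rewrite ler_wpM2r ?normc_ge0 ?ler_norm.
have -> : a = Linf qb * b.
  apply/val_inj/funext => n; rewrite [RHS]/= -[RHS]/(a n / b n * b n).
  have [bn|bn] := eqVneq (b n) 0; last by rewrite divfK.
  rewrite bn mulr0; apply: eq0_normc; apply/eqP; rewrite eq_le normc_ge0 andbT.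
  by apply: le_trans (ab n) _; rewrite bn normc0 mulr0.
by case: symS => -[_ _ _ h] _; exact: (h _ _ Logic.I Sb).1.
Qed.

Lemma sym_push f a : S a -> S (push_linf f a).
Proof. by move=> Sa; case: symS => _; apply; exists a. Qed.

(** Along some injection [b] stays away from 0; pulled back along it, [b] dominates every bounded
    sequence. *)
Lemma sym_not_vanishing (b : linf R) : S b -> ~ vanishing (fun n => normc (b n)) ->
  forall a, S a.
Proof.
move=> Sb nv a.
have [eps eps0 beps] : exists2 eps : R, 0 < eps &
    forall N, exists2 n, (N <= n)%N & eps <= normc (b n).
  apply: contrapT => ne; apply: nv => eps eps0; apply: contrapT => nN.
  apply: ne; exists eps => // N; apply: contrapT => nn; apply: nN; exists N => n Nn.
  by rewrite ltNge; apply/negP => h; apply: nn; exists n.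
have [h hi hb] := subsequence_ge beps.
have /bounded_seqP[M aM] := linf_bounded a.
have M0 : 0 <= M by apply: le_trans (aM 0%N); exact: normc_ge0.
apply: (@sym_dominated _ (push_linf (emb_inv (emb_of hi)) b) (M / eps)).
  exact: sym_push.
move=> n; have -> : push_linf (emb_inv (emb_of hi)) b n = b (h n).
  rewrite /= /push; have -> : emb_inv (emb_inv (emb_of hi)) n = Some (h n).
    by apply/emb_inv_funP; exact: emb_inv_of.
  by [].
apply: le_trans (aM n) _; rewrite mulrAC ler_pdivlMr// ler_wpM2l//.
Qed.

Definition sym_controlled (x : bop) :=
  exists s : linf R, S s /\ exists K, controlled (fun n => normc (s n)) K x.

Fact lincomb_bounded (k : R) (a b : linf R) :
  (fun n => (k * (normc (a n) + normc (b n)))%:C%C) \in @bounded_seq R.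
Proof.
have /bounded_seqP[M aM] := linf_bounded a.
have /bounded_seqP[N bN] := linf_bounded b.
apply/bounded_seqP; exists (`|k| * (M + N)) => n.
rewrite normc_real normrM ler_wpM2l// ger0_norm ?addr_ge0 ?normc_ge0//.
exact: lerD.
Qed.

Lemma sym_abs_comb (k : R) (a b : linf R) : 0 <= k -> S a -> S b ->
  S (Linf (lincomb_bounded k a b)).
Proof.
move=> k0 Sa Sb.
pose A := Linf (lincomb_bounded k a 0); pose B := Linf (lincomb_bounded k b 0).
have SA c D : S c -> D = Linf (lincomb_bounded k c 0) -> S D.
  move=> Sc ->; apply: (@sym_dominated _ c k) => // n.
  rewrite normc_real normc0 addr0 ger0_norm ?mulr_ge0 ?normc_ge0//.
have -> : Linf (lincomb_bounded k a b) = A + B.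
  apply/val_inj/funext => n; rewrite [RHS]/= fctE -[RHS]rmorphD /=.
  by rewrite normc0 !addr0 mulrDr.
by apply: symD; [apply: SA Sa _|apply: SA Sb _].
Qed.

(** Both families of test vectors are imposed at once, so codimensions add; the bound splits as t =
    |c| t1 + t1. *)
Lemma sym_controlled_lin c x y :
  sym_controlled x -> sym_controlled y -> sym_controlled (c *: x + y).
Proof.
move=> [s [Ss [K sx]]] [s' [Ss' [K' sy]]].
have k0 : 0 < normc c + 1 by rewrite ltr_wpDl ?normc_ge0.
exists (Linf (lincomb_bounded (normc c + 1) s s')); split.
  by apply: sym_abs_comb => //; exact: ltW.
exists (K + K')%N => E t t0 Et.
pose t1 := t / (normc c + 1).
have t10 : 0 <= t1 by rewrite divr_ge0// ltW.
have tE m : m \notin E -> normc (s m) + normc (s' m) <= t1.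
  move=> /Et /=; rewrite normc_real ger0_norm ?mulr_ge0 ?addr_ge0 ?normc_ge0 ?(ltW k0)//.
  by rewrite ler_pdivlMr// mulrC.
have [phi phiP] := sx E t1 t10 (fun m h => le_trans (ler_wpDr (normc_ge0 _) (lexx _)) (tE m h)).
have [psi psiP] := sy E t1 t10 (fun m h => le_trans (ler_wpDl (normc_ge0 _) (lexx _)) (tE m h)).
rewrite mulnDl.
exists (fun i => match fintype.split i with inl j => phi j | inr j => psi j end) => v v0.
have -> : t = normc c * t1 + t1.
  by rewrite -{2}[t1]mul1r -mulrDl /t1 mulrC divfK// gt_eqF.
rewrite mulrDl; apply: le_trans (ell2_normD _ _) _; apply: lerD.
  rewrite ell2_normZ -mulrA ler_wpM2l ?normc_ge0//; apply: phiP => i.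
  by have := v0 (lshift _ i); rewrite -[lshift _ _]/(unsplit (inl i)) unsplitK.
apply: psiP => i.
by have := v0 (rshift _ i); rewrite -[rshift _ _]/(unsplit (inr i)) unsplitK.
Qed.

(** Left multiplication scales the bound; right multiplication also pulls the test vectors back by
    the adjoint. The factor [M + 1] stays invertible when [M] is 0. *)
Lemma sym_controlled_mul a x : sym_controlled x ->
  sym_controlled (a * x) /\ sym_controlled (x * a).
Proof.
move=> [s [Ss [K sx]]]; have [M M0 aM] := bop_bound a.
have k0 : 0 < M + 1 by rewrite ltr_wpDl.
have bound t : 0 <= t -> 0 <= t / (M + 1) /\ M * (t / (M + 1)) <= t.
  move=> t0; split; first by rewrite divr_ge0// ltW.
  rewrite mulrA ler_pdivrMr// mulrC mulrDr mulr1 lerDl//.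
have SS : S (Linf (lincomb_bounded (M + 1) s 0)).
  by apply: sym_abs_comb => //; [exact: ltW|exact: sym0].
have sE E t : (forall m, m \notin E ->
    normc (Linf (lincomb_bounded (M + 1) s 0) m) <= t) ->
    forall m, m \notin E -> normc (s m) <= t / (M + 1).
  move=> Et m /Et /=; rewrite normc0 addr0 normc_real.
  rewrite ger0_norm ?mulr_ge0 ?normc_ge0 ?(ltW k0)//.
  by rewrite ler_pdivlMr// mulrC.
split; exists (Linf (lincomb_bounded (M + 1) s 0)); (split; first by []);
  exists K => E t t0 /sE Et; have [t10 tM] := bound _ t0.
  have [phi phiP] := sx E _ t10 Et; exists phi => v /phiP xv.
  apply: le_trans (aM _) _; apply: le_trans (ler_wpM2l M0 xv) _.
  by rewrite mulrA ler_wpM2r ?ell2_norm_ge0.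
have [phi phiP] := sx E _ t10 Et; exists (fun i => adj a (phi i)) => v v0.
have -> : (x * a) v = x (a v) by [].
apply: le_trans (phiP _ _) _ => [i|]; first by rewrite -dot_adjr.
apply: le_trans (ler_wpM2l t10 (aM v)) _.
by rewrite mulrA [_ * M]mulrC ler_wpM2r ?ell2_norm_ge0.
Qed.

Lemma sym_controlled_diag a : S a -> sym_controlled (diag a).
Proof.
move=> Sa; exists a; split => //; exists 1%N => E t t0 Et.
rewrite mul1n; exists (fun i => e_ (nth 0%N E i)) => v v0.
apply: ell2_norm_dominated => // n; rewrite [diag a v n]/= normcM.
have [nE|nE] := boolP (n \in E); last by rewrite ler_wpM2r ?normc_ge0// Et.
have nE' : (index n E < size E)%N by rewrite index_mem.
have := v0 (Ordinal nE'); rewrite dot_basisr /= nth_index// => ->.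
by rewrite normc0 !mulr0.
Qed.

(** The controlled operators form an ideal containing the generators of [J_ S]. *)
Lemma J_controlled x : J_ S x -> sym_controlled x.
Proof.
apply; split; last by move=> _ [a Sa <-]; exact: sym_controlled_diag.
split=> //.
- by have := sym_controlled_diag sym0; rewrite diag0.
- exact: sym_controlled_lin.
- by move=> a y _; exact: sym_controlled_mul.
Qed.

(** If |a| >= eps infinitely often, enough such indices, compared with the level eps/2 of [s], give
    eps <= eps/2. *)
Lemma controlled_vanishing (s : linf R) K (a : linf R) :
  vanishing (fun n => normc (s n)) ->
  controlled (fun n => normc (s n)) K (diag a) -> vanishing (fun n => normc (a n)).
Proof.
move=> sv sa eps eps0; apply: contrapT => nN.
have [|h hi hP] := @subsequence_ge (fun n => eps <= normc (a n)).
  move=> N; apply: contrapT => nn; apply: nN; exists N => n Nn.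
  by rewrite ltNge; apply/negP => h; apply: nn; exists n.
have e20 : 0 < eps / 2 by rewrite divr_gt0.
have [N sN] := sv _ e20.
have := @controlled_diag_le _ _ _ (K * size (iota 0 N)).+1 (fun i => h i)
  (iota 0 N) (eps / 2) eps sa.
have inj : injective (fun i : 'I_(K * size (iota 0 N)).+1 => h i).
  by move=> i j /hi /val_inj.
move=> /(_ inj (ltnSn _) (ltW e20)).
have sN' m : m \notin iota 0 N -> normc (s m) <= eps / 2.
  by rewrite mem_iota add0n -leqNgt => /sN /ltW.
move=> /(_ sN' (fun i => hP i)).
by rewrite leNgt ltr_pdivrMr// ltr_pMr// ltr1n.
Qed.

(* With decreasing enumerations p of |a| and q of |s|, control gives
   |a (p n)| <= |s (q (n %/ K.+1))|, so a splits into K.+1 pieces, each dominated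
   by a push-forward of s. *)
Lemma J_diag a : J_ S (diag a) -> S a.
Proof.
move=> /J_controlled[s [Ss [K sa]]].
have [sv|] := pselect (vanishing (fun n => normc (s n))); last first.
  by move/(sym_not_vanishing Ss); apply.
have av := controlled_vanishing sv sa.
have [p [pi pmax psurj]] := decreasing_enumeration (fun n => normc_ge0 (a n)) av.
have [q [qi qmax _]] := decreasing_enumeration (fun n => normc_ge0 (s n)) sv.
(* Compare the n+1 largest entries of [a] with [s] off its n/(K+1) largest: K times n/(K+1) is less
   than n+1. *)
have dom n : normc (a (p n)) <= normc (s (q (n %/ K.+1)%N)).
  apply: (@controlled_diag_le _ _ _ n.+1 (fun i => p i)
    [seq q i | i <- iota 0 (n %/ K.+1)%N] _ _ sa) => //.
  - by move=> i j /pi /val_inj.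
  - rewrite size_map size_iota ltnS.
    by apply: leq_trans (leq_divM n K.+1); rewrite mulnC leq_mul2l leqnSn orbT.
  - exact: normc_ge0.
  - by move=> m /qmax.
  - move=> i; apply: pmax; apply/negP => /mapP[j]; rewrite mem_iota add0n => /andP[_ ji].
    by move/pi; have := ltn_ord i; lia.
have [r rP] : exists r : nat -> nat, forall n, r (p n) = n.
  exists (fun m => odflt 0%N (emb_inv (emb_of pi) m)) => n.
  by rewrite emb_inv_of.
pose c m := @inord K (r m %% K.+1)%N.
have gi (i : 'I_K.+1) : injective (fun k => p (k * K.+1 + i)%N).
  by move=> k l /pi /addIn/eqP; rewrite eqn_mul2r /= => /eqP.
(* [f i] sends q k to p (k (K+1) + i), so pushing [s] along it supplies the bound [dom] on residue
   class i. *)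
pose f i := emb_comp (emb_of (@gi i)) (emb_inv (emb_of qi)).
have -> : a = \sum_(i < K.+1) indic_linf R (fun m => c m == i) * a.
  by rewrite -mulr_suml sum_indic_linf mul1r.
apply: big_ind => [|x y|i _]; [exact: sym0|exact: symD|].
apply: (@sym_dominated _ (push_linf (f i) s) 1); first exact: sym_push.
move=> m; rewrite mul1r -[X in normc X]/((c m == i)%:R * a m) normcM.
have [cm|_] := eqVneq (c m) i; last by rewrite normc0 mul0r normc_ge0.
rewrite normc1 mul1r.
(* The enumeration [p] may miss zeros of [a], where domination is trivial. *)
have [->|am] := eqVneq (normc (a m)) 0; first exact: normc_ge0.
have [|n nm] := psurj m; first by rewrite lt_def am normc_ge0.
suff -> : push_linf (f i) s m = s (q (n %/ K.+1)%N) by rewrite -nm dom.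
have -> : push_linf (f i) s m = oapp s 0 (emb_inv (f i) m) by [].
have -> : emb_inv (f i) m = Some (q (n %/ K.+1)%N); last by [].
apply/emb_inv_funP; have -> : f i (q (n %/ K.+1)%N) =
  obind (emb_of (@gi i)) (emb_inv (emb_of qi) (q (n %/ K.+1)%N)) by [].
rewrite emb_inv_of /= -nm; congr (Some (p _)).
rewrite {2}(divn_eq n K.+1); congr (_ + _)%N.
by rewrite -cm /c inordK -nm rP// ltn_pmod.
Qed.

End SymmetricIdeal.

(** * Traces of ideals on Gamma *)

Lemma J_ideal (S : set (linf R)) : two_sided_ideal setT (J_ S).
Proof.
split=> //.
- by move=> A [[]].
- by move=> c x y Jx Jy A AP; case: (AP) => -[_ _ h _] _; apply: h; [exact: Jx|exact: Jy].
- move=> a x _ Jx; split=> A AP; case: (AP) => -[_ _ _ h] _.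
    exact: (h a x Logic.I (Jx _ AP)).1.
  exact: (h a x Logic.I (Jx _ AP)).2.
Qed.

(** The trace is an ideal of Gamma, hence given by its diagonals, and [J_diag] identifies these with
    [S]. *)
Lemma J_trace (S : set (linf R)) : symmetric_ideal S -> J_ S `&` Gamma R = I_ S.
Proof.
move=> symS; rewrite (Gamma_ideal_diag (trace_ideal (J_ideal S))).
congr I_; apply/seteqP; split=> a; first by move=> [] /(J_diag symS).
by move=> Sa; split; [move=> A [_]; apply; exists a|exact: Gamma_diag].
Qed.

Lemma ideal_sub_of_trace (J J' : set bop) : two_sided_ideal setT J ->
  two_sided_ideal setT J' -> J `&` Gamma R = J' `&` Gamma R -> J `<=` J'.
Proof.
move=> [_ _ _ JM] [_ _ _ J'M] JJ x Jx.
have [y Gy [A [B [A' [B' [yE ->]]]]]] := bidiagonalization x.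
have [J'y _] : (J' `&` Gamma R) y.
  rewrite -JJ; split=> //; rewrite yE.
  by apply: (JM _ _ Logic.I _).2; exact: (JM _ _ Logic.I Jx).1.
by apply: (J'M _ _ Logic.I _).2; exact: (J'M _ _ Logic.I J'y).1.
Qed.

End CalkinIdeals.

Theorem theorem1p1 (R : realType) :
  set_bij [set J : set (bop R) | two_sided_ideal setT J]
          [set I : set (bop R) | two_sided_ideal (Gamma R) I]
          (fun J => J `&` Gamma R)
  /\ (forall S : set (linf R), symmetric_ideal S -> J_ S `&` Gamma R = I_ S).
Proof.
split; last exact: J_trace.
split=> [J|J J' /set_mem Jid /set_mem J'id JJ|J Jid]; first exact: trace_ideal.
  apply/seteqP; split; first exact: ideal_sub_of_trace Jid J'id JJ.
  exact: ideal_sub_of_trace J'id Jid (esym JJ).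
(* Surjectivity: the preimage is the ideal generated by the diagonal operators in [J]. *)
exists (J_ (diag_part J)); first exact: J_ideal.
by rewrite J_trace -?Gamma_ideal_diag//; exact: diag_part_ideal.
Qed.
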